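(* Let $\alpha,\beta,\alpha_1,\beta_1\in\mathbb{R}$ with $\beta\neq 0$, $\beta\neq\beta_1$, and let $0<\mu\le 1$, $0\le\nu\le 1$. Consider the cobweb model with Hilfer fractional derivative in the demand function $$D(t)=\alpha+\beta\bigl(p(t)+D_{0+}^{\mu,\nu}p(t)\bigr),\qquad S(t)=\alpha_1+\beta_1 p(t),\qquad D(t)=S(t).$$ The unique solution of this cobweb model is given by $$p(t)=C\,t^{\gamma-1}E_{\mu,\gamma}(\lambda t^{\mu})-\frac{\xi}{\lambda}+\frac{\xi}{\lambda}E_{\mu}(\lambda t^{\mu}),$$ where $\lambda=\dfrac{\beta_1-\beta}{\beta}$, $\xi=\dfrac{\alpha_1-\alpha}{\beta}$ and $C\in\mathbb{R}$.
   Context: Here $p(t)$ is the market price, $D(t)$ the demand and $S(t)$ the supply at time $t$. The parameter $\gamma$ is $\gamma=\mu+\nu-\mu\nu$. The Riemann-Liouville fractional integral of order $\sigma>0$ is $I_{0+}^{\sigma}g(t)=\frac{1}{\Gamma(\sigma)}\int_0^t(t-s)^{\sigma-1}g(s)\,ds$, and $I_{0+}^0$ is the identity. The Hilfer fractional derivative of order $\mu$ and type $0\le\nu\le1$ is $D_{0+}^{\mu,\nu}g(t)=I_{0+}^{\nu(1-\mu)}\,\frac{d}{dt}\,I_{0+}^{(1-\nu)(1-\mu)}g(t)$. The Mittag-Leffler functions are $E_{\mu,\gamma}(z)=\sum_{k=0}^{\infty}\frac{z^k}{\Gamma(\mu k+\gamma)}$ and $E_\mu(z)=E_{\mu,1}(z)$.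 *)

(* Defs.v *)
From HB Require Import structures.
From mathcomp Require Import all_boot all_order all_algebra.
From mathcomp Require Import all_classical all_reals all_analysis.
Set Implicit Arguments.
Unset Strict Implicit.
Unset Printing Implicit Defensive.
Import Order.TTheory GRing.Theory Num.Theory.
Import numFieldNormedType.Exports.
Local Open Scope classical_set_scope.
Local Open Scope ring_scope.

Section FractionalCalculus.
Context {R : realType}.
Implicit Types (sigma mu nu gamma z t : R) (g : R -> R).

(* Meaningful for 0 < sigma only. *)
Definition Gamma sigma : R :=
  \int[lebesgue_measure]_(s in `]0, +oo[) (s `^ (sigma - 1) * expR (- s)).

Definition mittag_leffler2 mu gamma z : R :=
  limn (series (fun k : nat => z ^+ k / Gamma (mu * k%:R + gamma))).

Definition mittag_leffler mu z : R := mittag_leffler2 mu 1 z.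

Definition RL_kernel sigma g t : R -> R :=
  fun s => (t - s) `^ (sigma - 1) * g s.

(* Functions are only ever observed on the open half-line 0 < t, where the
   solutions live: they may be singular at the origin. *)
Definition RL_integral sigma g t : R :=
  if sigma == 0 then g t
  else (Gamma sigma)^-1 *
       \int[lebesgue_measure]_(s in `]0, t[) RL_kernel sigma g t s.

(* [Rintegral] and [derive1] are total, so the existence of the integrals and
   of the derivative is recorded by the predicates [RL_integrable] and
   [hilfer_derivable]. *)
Definition RL_integrable sigma g t : Prop :=
  sigma != 0 ->
  lebesgue_measure.-integrable `]0, t[ (EFin \o RL_kernel sigma g t).

Definition hilfer_derivative mu nu g : R -> R :=
  RL_integral (nu * (1 - mu))
    (derive1 (RL_integral ((1 - nu) * (1 - mu)) g)).

Definition hilfer_derivable mu nu g t : Prop :=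
  let F := RL_integral ((1 - nu) * (1 - mu)) g in
  [/\ forall s, 0 < s <= t -> RL_integrable ((1 - nu) * (1 - mu)) g s,
      forall s, 0 < s <= t -> derivable F s 1
    & RL_integrable (nu * (1 - mu)) (derive1 F) t].

End FractionalCalculus.

Section Cobweb.
Context {R : realType}.
Implicit Types (alpha beta mu nu t : R) (p : R -> R).

Definition cobweb_demand alpha beta mu nu p t : R :=
  alpha + beta * (p t + hilfer_derivative mu nu p t).

Definition cobweb_supply alpha1 beta1 p t : R := alpha1 + beta1 * p t.

Definition cobweb_solution alpha beta alpha1 beta1 mu nu p : Prop :=
  forall t, 0 < t ->
    hilfer_derivable mu nu p t /\
    cobweb_demand alpha beta mu nu p t = cobweb_supply alpha1 beta1 p t.

End Cobweb.

(* Main.v *)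
Require Import Defs.
From HB Require Import structures.
From mathcomp Require Import all_boot all_order all_algebra.
From mathcomp Require Import all_classical all_reals all_analysis.
From mathcomp Require Import measurable_realfun.
From mathcomp Require Import ring lra.
Set Implicit Arguments.
Unset Strict Implicit.
Unset Printing Implicit Defensive.
Import Order.TTheory GRing.Theory Num.Theory.
Import numFieldNormedType.Exports.
Local Open Scope classical_set_scope.
Local Open Scope ring_scope.

(** Write [a = (1 - nu) * (1 - mu)] and [b = nu * (1 - mu)], so that
    [mu + a + b = 1] and [gamma = mu + b].  After division by [beta] the market
    equation becomes, on the half-line [0 < t],
      [I^b (I^a p)' = xi + lambda p],
    which [hilfer_solution] expresses and [cobweb_hilfer] derives.

    Put [e_d t = t^(d-1) E_{mu,d}(lambda t^mu)], that is, the sum over [k] of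
    [lambda^k t^(mu k + d - 1) / Gamma (mu k + d)] ([mlf] below).  The beta
    integral says that [I^s] sends [t^(d-1) / Gamma d] to
    [t^(d+s-1) / Gamma (d+s)] ([frac_kernel_conv]); summing over [k] under
    dominated convergence, [I^s e_d = e_{d+s}] ([RL_integral_mlf]).  Hence
    [e_{d+1}' = e_d], and splitting off the first term gives
    [e_1 = 1 + lambda e_{mu+1}].  The formula of the theorem is therefore
    [p = C e_gamma + xi e_{mu+1}].  It is a solution, because
    [I^a p = C e_1 + xi e_{mu+1+a}] has derivative
    [C lambda e_mu + xi e_{mu+a}], whose image under [I^b] is
    [C lambda e_gamma + xi e_1 = xi + lambda p] ([ml_solutionP]).

    For uniqueness let [F = I^a p] and [G = F'], and suppose [mu < 1].  Applying
    [I^a] to the equation gives [I^{1-mu} G = xi t^a / Gamma (1+a) + lambda F],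
    by the semigroup law [RL_semigroup], a consequence of Fubini's theorem.  In
    particular [G] is integrable near 0, and a further [I^mu] turns the left-hand
    side into the integral of [G] over ]0, t[.  As [F] is differentiable at every
    point with an integrable derivative, although [G] need not be continuous, the
    fundamental theorem of calculus [Rintegral_derive1] holds for it, and [F] is
    a constant [c] plus that integral.  The constant is additive in [p], and it
    is [C] for the solution written above.  Choosing [C = c], the difference [q]
    of the two solutions solves the equation with [xi = 0] and has [c = 0], so
    that its [F] satisfies [F = lambda I^mu F].  This [F] is bounded near 0, and
    iterating the equation bounds it by [M |lambda|^k t^(mu k) / Gamma (mu k + 1)]
    for every [k], a null sequence ([volterra_zero]).  So [F = 0], hence [G = 0],
    and the differential equation itself, [lambda q = I^b G = 0], yields [q = 0]
    at every point and not merely almost everywhere.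

    When [mu = 1] no integration is left, and [p' = xi + lambda p] is solved by
    the integrating factor [exp (- lambda t)]; the value [Gamma (k+1) = k!]
    identifies [e_1] with [exp (lambda t)]. *)

(** * Truncated powers, the Gamma function and the beta integral *)

Section PowerKernel.
Context {R : realType}.
Implicit Types (a b c d x y s t : R).
Local Notation mu := (@lebesgue_measure R).

Lemma derivable1_continuous (f : R -> R) x :
  derivable f x 1 -> {for x, continuous f}.
Proof. by move/derivable1_diffP/differentiable_continuous. Qed.

(** The measure [c * mu (phi^-1 A)], with [phi x = c x + d], agrees with the
    Lebesgue measure on half-open intervals, hence everywhere. *)
Lemma ge0_integral_affine c d (f : R -> \bar R) : 0 < c ->
  measurable_fun setT f -> (forall x, 0 <= f x)%E ->
  (\int[mu]_x f x = c%:E * \int[mu]_x f (c * x + d)%R)%E.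
Proof.
move=> c0 mf f0.
pose phi (x : R) : measurableTypeR R := c * x + d.
have mphi : measurable_fun setT phi.
  exact: measurable_funD.
pose pnu : {measure set (measurableTypeR R) -> \bar R} := pushforward mu phi.
pose nu : {measure set (measurableTypeR R) -> \bar R} :=
  mscale (NngNum (ltW c0)) (pnu mphi).
have nuE A : measurable A -> mu A = nu A.
  move=> mA.
  apply: (@lebesgue_measure_unique R nu) => //= _ [[u v]] _ <-.
  rewrite /nu /mscale /= /pushforward.
  have -> : phi @^-1` `]u, v] = `]((u - d) / c), ((v - d) / c)]%classic.
    apply/seteqP; split => x /=; rewrite !in_itv/= /phi;
      by rewrite ltr_pdivrMr// ler_pdivlMr// ltrBlDr lerBrDr mulrC.
  rewrite !lebesgue_measure_itv/= !lte_fin ltr_pM2r ?invr_gt0// ltrD2r.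
  case: ifPn => uv; last by rewrite mule0.
  by rewrite -EFinM -!EFinB; congr EFin; field; exact: lt0r_neq0.
transitivity (\int[nu]_x f x)%E.
  by apply: eq_measure_integral => A mA _; exact: nuE.
rewrite ge0_integral_mscale//=; congr (_ * _)%E.
by rewrite ge0_integral_pushforward.
Qed.

(** The function [x_+^(a-1)].  Its vanishing on [x <= 0] lets every integral over
    ]0, t[ be written over the whole line, where translation, scaling and Fubini
    apply without side conditions. *)
Definition tpow a x : R := if 0 < x then x `^ (a - 1) else 0.

Lemma tpowE a x : 0 < x -> tpow a x = x `^ (a - 1).
Proof. by rewrite /tpow => ->. Qed.

Lemma tpow0 a x : x <= 0 -> tpow a x = 0.
Proof. by rewrite /tpow leNgt => /negbTE ->. Qed.

Lemma tpow_ge0 a x : 0 <= tpow a x.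
Proof. by rewrite /tpow; case: ifP => // _; exact: powR_ge0. Qed.

Lemma tpowM a x y : 0 < x -> tpow a (x * y) = x `^ (a - 1) * tpow a y.
Proof.
move=> x0; rewrite /tpow pmulr_rgt0//; case: ifPn => [y0|]; last by rewrite mulr0.
by rewrite powRM// ltW.
Qed.

Lemma measurable_tpow a : measurable_fun setT (tpow a).
Proof.
apply: (@measurable_fun_ifT _ _ _ _ (fun x => x `^ (a - 1)) (cst 0) (fun x => 0 < x)) => //.
exact: measurable_fun_ltr.
Qed.

Lemma continuous_tpow a x : 0 < x -> {for x, continuous (tpow a)}.
Proof.
move=> x0; rewrite /prop_for /continuous_at tpowE//.
have c : (fun y => y `^ (a - 1)) @ x --> x `^ (a - 1).
  apply: (@derivable1_continuous (fun y => y `^ (a - 1))).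
  by have [] := is_derive1_powR (a - 1) x0.
apply: cvg_trans c; apply: near_eq_cvg; near=> y.
by rewrite tpowE//; near: y; exact: lt_nbhsr.
Unshelve. all: by end_near. Qed.

(** The primitive [x^a / a] bounds the integral over [1/n, 1] by [1/a], and
    monotone convergence exhausts ]0, 1]. *)
Lemma integrable_tpow01 a : 0 < a ->
  (\int[mu]_(x in `]0%R, 1%R]) (tpow a x)%:E < +oo)%E.
Proof.
move=> a0.
pose S (n : nat) : set (measurableTypeR R) := `[n.+1%:R^-1 : R, 1]%classic.
have nd : nondecreasing_seq S.
  move=> m n mn; apply/subsetPset; apply: subset_itvr; rewrite bnd_simp.
  by rewrite lef_pV2 ?posrE// ler_nat.
have mS i : measurable (S i) by exact: measurable_itv.
have SE : \bigcup_i S i = `]0, 1]%classic.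
  apply/seteqP; split => x.
    move=> [n _]; rewrite /S /= !in_itv/= => /andP[nx x1]; rewrite x1 andbT.
    by rewrite (lt_le_trans _ nx).
  rewrite /= !in_itv/= => /andP[x0 x1].
  exists (Num.truncn x^-1) => //=; rewrite /S/= in_itv/= x1 andbT.
  rewrite -[leRHS]invrK lef_pV2 ?posrE ?invr_gt0//.
  by rewrite ltW// truncnS_gt.
have mk (D : set (measurableTypeR R)) : measurable_fun D (fun x => (tpow a x)%:E).
  by apply: measurable_funTS; apply/measurable_EFinP; exact: measurable_tpow.
have k0 x : (0 <= (tpow a x)%:E)%E by rewrite lee_fin tpow_ge0.
have := @ge0_nondecreasing_set_cvg_integral _ _ _ S
  (fun x : measurableTypeR R => (tpow a x)%:E) mu nd mS (fun i => mk _) (fun i x _ => k0 x).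
rewrite SE => /cvg_lim <- //.
apply: (@le_lt_trans _ _ (a^-1)%:E); last exact: ltry.
apply: lime_le.
  apply: ereal_nondecreasing_is_cvgn; apply: ge0_nondecreasing_set_nondecreasing_integral => //.
apply: nearW => -[|n].
  rewrite /S invr1 set_itv1 integral_set1 lee_fin invr_ge0 ltW//.
have h0 : 0 < n.+2%:R^-1 :> R by rewrite invr_gt0.
rewrite (@continuous_FTC2 R (tpow a) (fun x => a^-1 * x `^ a))//.
- rewrite powR1 mulr1 -EFinB lee_fin gerBl mulr_ge0 ?powR_ge0// invr_ge0 ltW//.
- by rewrite invf_lt1// ltr1n.
- apply: continuous_in_subspaceT => x; rewrite inE/= in_itv/= => /andP[nx _].
  have x0 : 0 < x by rewrite (lt_le_trans _ nx).
  exact: continuous_tpow.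
- have D x : 0 < x -> derivable (fun x => a^-1 * x `^ a) x 1.
    by move=> x0; apply: derivableM => //; apply: derivable_powR; rewrite in_itv/= x0.
  split.
  + by move=> x; rewrite in_itv/= => /andP[nx _]; apply: D; rewrite (lt_trans _ nx).
  + apply: cvg_at_right_filter.
    apply: (@derivable1_continuous (fun x => a^-1 * x `^ a)); exact: D.
  + apply: cvg_at_left_filter.
    apply: (@derivable1_continuous (fun x => a^-1 * x `^ a)); exact: D.
- move=> x; rewrite in_itv/= => /andP[nx _].
  have x0 : 0 < x by rewrite (lt_trans _ nx).
  have dx := is_derive1_powR a x0.
  rewrite derive1Ml; last by [].
  by rewrite derive1E; rewrite derive_val tpowE// mulrA mulVf ?mul1r// gt_eqF.
Qed.

End PowerKernel.

Section GammaFunction.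
Context {R : realType}.
Implicit Types (a b c d x y s t : R).
Local Notation mu := (@lebesgue_measure R).

Lemma integral_itv0y (f : R -> R) :
  (\int[mu]_(x in `]0%R, +oo[) (f x)%:E = \int[mu]_x (tpow 1 x * f x)%:E)%E.
Proof.
rewrite integral_mkcond; apply: eq_integral => x _; rewrite patchE.
case: ifPn => [|/negP]; rewrite inE/= in_itv/= andbT => x0.
  by rewrite tpowE// subrr powRr0 mul1r.
by rewrite tpow0 ?mul0r// leNgt; exact/negP.
Qed.

Lemma integral_tpow1_expRN : (\int[mu]_x (tpow 1 x * expR (- x))%:E = 1)%E.
Proof.
rewrite -(@integral_exponential_pdf R 1)// -integral_itv0y.
rewrite integral_itv_obnd_cbnd; last first.
  by apply/measurable_EFinP; apply: measurableT_comp => //; exact: measurable_funTS.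
rewrite [LHS]integral_mkcond; apply: eq_integral => x _.
rewrite /exponential_pdf !patchE; case: ifPn => // _.
by rewrite mul1r mulN1r.
Qed.

Definition gamma_density a x : R := tpow a x * expR (- x).

Lemma gamma_density_ge0 a x : 0 <= gamma_density a x.
Proof. by rewrite mulr_ge0 ?tpow_ge0// expR_ge0. Qed.

Lemma measurable_gamma_density a : measurable_fun setT (gamma_density a).
Proof.
apply: measurable_funM; first exact: measurable_tpow.
exact: measurableT_comp.
Qed.

(** At infinity half of the decay of [exp (- x)] absorbs the power:
    [ln x <= c x - ln c], with [c] so small that [|a - 1| c <= 1/2]. *)
Lemma tpow_le_expR a : exists2 K : R, 0 <= K &
  forall x, 1 <= x -> tpow a x <= K * expR (x / 2).
Proof.
pose m := `|a - 1|; pose c : R := (2 * (m + 1))^-1.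
have m0 : 0 <= m by exact: normr_ge0.
have m1 : 0 < m + 1 by rewrite ltr_wpDl.
have c0 : 0 < c by rewrite invr_gt0 mulr_gt0.
exists (expR (- m * ln c)); first exact: expR_ge0.
move=> x x1; have x0 : 0 < x by exact: lt_le_trans x1.
rewrite tpowE// /powR gt_eqF// -expRD ler_expR.
have lnx0 : 0 <= ln x by exact: ln_ge0.
have h1 : (a - 1) * ln x <= m * ln x by rewrite ler_wpM2r// ler_norm.
have h2 : ln x <= c * x - ln c.
  by rewrite lerBrDl -lnM ?posrE// ltW// ln_sublinear// mulr_gt0.
have h3 : m * ln x <= m * (c * x - ln c) by rewrite ler_wpM2l.
have h4 : m * c <= 2^-1.
  by rewrite /c invfM mulrCA ler_piMr// ler_pdivrMr// mul1r lerDl.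
have h5 : m * c * x <= 2^-1 * x by rewrite ler_wpM2r// ltW.
lra.
Qed.

Lemma integral_gamma_density_lty a : 0 < a ->
  (\int[mu]_x (gamma_density a x)%:E < +oo)%E.
Proof.
move=> a0; have [K K0 hK] := tpow_le_expR a.
pose g1 := (tpow a) \_ `]0, 1].
pose g2 x := 2 * K * exponential_pdf 2^-1 x.
have g10 x : 0 <= g1 x.
  by apply: restrict_ge0 => {}x _; exact: tpow_ge0.
have p0 x : 0 <= exponential_pdf (2^-1 : R) x by apply: exponential_pdf_ge0; rewrite invr_ge0.
have g20 x : 0 <= g2 x by rewrite mulr_ge0// mulr_ge0.
have mg1 : measurable_fun setT g1.
  by apply/measurable_restrict => //; rewrite ?setTI;
    apply: measurable_funTS; exact: measurable_tpow.
have mp : measurable_fun setT (exponential_pdf (2^-1 : R)) by exact: measurable_exponential_pdf.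
have mg2 : measurable_fun setT g2 by apply: measurable_funM.
apply: (@le_lt_trans _ _ (\int[mu]_x ((g1 x)%:E + (g2 x)%:E))%E).
  apply: ge0_le_integral => //.
  - by move=> x _; rewrite lee_fin gamma_density_ge0.
  - by apply/measurable_EFinP; exact: measurable_gamma_density.
  - by apply: emeasurable_funD; apply/measurable_EFinP.
  - move=> x _; rewrite -EFinD lee_fin /gamma_density.
    have [x0|x0] := leP x 0; first by rewrite tpow0// mul0r addr_ge0.
    have [x1|x1] := leP x 1.
      apply: (@le_trans _ _ (g1 x)); last by rewrite lerDl.
      rewrite /g1 patchE ifT; last by rewrite inE/= in_itv/= x0 x1.
      by rewrite ler_piMr ?tpow_ge0// -expR0 ler_expR oppr_le0 ltW.
    apply: (@le_trans _ _ (g2 x)); last by rewrite lerDr.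
    rewrite /g2 exponential_pdfE; last exact: ltW.
    apply: (@le_trans _ _ (K * expR (x / 2) * expR (- x))).
      by rewrite ler_wpM2r ?expR_ge0// hK// ltW.
    rewrite -mulrA -expRD.
    have -> : x / 2 - x = - 2^-1 * x by field.
    lra.
rewrite ge0_integralD//; last 4 first.
- by move=> x _; rewrite lee_fin.
- by apply/measurable_EFinP.
- by move=> x _; rewrite lee_fin.
- by apply/measurable_EFinP.
apply: lte_add_pinfty.
  have := integrable_tpow01 a0; rewrite [X in (X < _)%E -> _]integral_mkcond; congr (_ < _)%E.
  by apply: eq_integral => x _; rewrite /g1 !patchE; case: ifP.
under eq_integral do rewrite /g2 EFinM.
rewrite ge0_integralZl//.
- by rewrite integral_exponential_pdf// mule1 ltry.
- by apply/measurable_EFinP.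
- by move=> x _; rewrite lee_fin.
- by rewrite lee_fin mulr_ge0.
Qed.

Lemma GammaE a : 0 < a -> (\int[mu]_x (gamma_density a x)%:E = (Gamma a)%:E)%E.
Proof.
move=> a0.
have E : (\int[mu]_x (gamma_density a x)%:E =
    \int[mu]_(x in `]0%R, +oo[) (x `^ (a - 1) * expR (- x))%:E)%E.
  rewrite integral_itv0y; apply: eq_integral => x _; congr EFin.
  rewrite /gamma_density; have [x0|x0] := leP x 0; first by rewrite !tpow0// !mul0r.
  by rewrite !tpowE// subrr powRr0 mul1r.
rewrite E /Gamma /Rintegral fineK// -E ge0_fin_numE; first exact: integral_gamma_density_lty.
by apply: integral_ge0 => x _; rewrite lee_fin gamma_density_ge0.
Qed.

Lemma Gamma1 : Gamma 1 = 1 :> R.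
Proof. by apply: EFin_inj; rewrite -GammaE// integral_tpow1_expRN. Qed.

(** A lower bound for the density on a window of length one is a lower bound for
    [Gamma]. *)
Lemma Gamma_lower_bound a u m : 0 < a -> 0 <= m ->
  (forall x, u < x <= u + 1 -> m <= gamma_density a x) -> m <= Gamma a.
Proof.
move=> a0 m0 hm; rewrite -lee_fin -GammaE//.
apply: (@le_trans _ _ (\int[mu]_(x in `]u, (u + 1)%R]) (gamma_density a x)%:E)%E); last first.
  apply: ge0_subset_integral => //.
  - by apply/measurable_EFinP; exact: measurable_gamma_density.
  - by move=> x _; rewrite lee_fin gamma_density_ge0.
apply: (@le_trans _ _ (\int[mu]_(x in `]u, (u + 1)%R]) m%:E)%E).
  rewrite integral_cst//= lebesgue_measure_itv/= lte_fin ltrDl ltr01.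
  by rewrite -EFinB addrAC subrr add0r mule1.
apply: ge0_le_integral => //.
by apply/measurable_EFinP; apply: measurable_funTS; exact: measurable_gamma_density.
Qed.

(** The window ]a, a + 1] shows that [Gamma x] outgrows [a^x] for every [a].  This
    crude bound replaces Stirling's formula: it gives [0 < Gamma x], and the
    infinite radius of convergence of the Mittag-Leffler series. *)
Lemma Gamma_ge_pow a x : 0 < x -> 0 < a ->
  a `^ x / (a + 1) * expR (- (a + 1)) <= Gamma x.
Proof.
move=> x0 a0; have a1 : 0 < a + 1 by rewrite addr_gt0.
apply: (@Gamma_lower_bound _ a) => //.
  by rewrite mulr_ge0 ?divr_ge0 ?powR_ge0 ?expR_ge0// ltW.
move=> y /andP[ay ya]; have y0 : 0 < y by rewrite (lt_trans a0).
rewrite /gamma_density tpowE// powRB ?(gt_eqF y0) ?implybT// powRr1 ?(ltW y0)//.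
rewrite ler_pM ?divr_ge0 ?powR_ge0 ?expR_ge0 ?(ltW a1)//; last by rewrite ler_expR lerN2.
rewrite ler_pM ?powR_ge0 ?invr_ge0 ?(ltW a1)//; last by rewrite lef_pV2.
by rewrite ge0_ler_powR ?nnegrE ?(ltW ay)// ltW.
Qed.

Lemma Gamma_gt0 x : 0 < x -> 0 < Gamma x.
Proof.
move=> x0; apply: lt_le_trans (Gamma_ge_pow x0 ltr01).
by rewrite mulr_gt0 ?divr_gt0 ?powR_gt0 ?expR_gt0.
Qed.

(** The kernel of [I^a], also called the Gelfand-Shilov distribution
    [x_+^(a-1) / Gamma a]. *)
Definition frac_kernel a x : R := tpow a x / Gamma a.

Lemma frac_kernel_ge0 a x : 0 < a -> 0 <= frac_kernel a x.
Proof. by move=> a0; rewrite divr_ge0 ?tpow_ge0 ?ltW ?Gamma_gt0. Qed.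

Lemma frac_kernel_le0 a x : x <= 0 -> frac_kernel a x = 0.
Proof. by move=> x0; rewrite /frac_kernel tpow0// mul0r. Qed.

Lemma frac_kernel1 x : 0 < x -> frac_kernel 1 x = 1.
Proof. by move=> x0; rewrite /frac_kernel tpowE// subrr powRr0 Gamma1 divr1. Qed.

Lemma measurable_frac_kernel a : measurable_fun setT (frac_kernel a).
Proof. by apply: measurable_funM => //; exact: measurable_tpow. Qed.

Let conv_measurable a b r t :
  measurable_fun setT (fun s => tpow a (t - s) * tpow b (s - r)).
Proof.
apply: measurable_funM; apply: (measurableT_comp (measurable_tpow _)).
  exact: measurable_funB.
exact: measurable_funB.
Qed.

(* The substitution [s = (t - r) x + r] reduces the convolution to [t = 1], [r = 0]. *)
Let tpow_conv_scale a b r t :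
  (\int[mu]_s (tpow a (t - s) * tpow b (s - r))%:E =
   (\int[mu]_s (tpow a (1 - s) * tpow b (s - 0))%:E) * (tpow (a + b) (t - r))%:E)%E.
Proof.
have [rt|tr] := ltP r t; last first.
  rewrite (tpow0 (a + b)) ?subr_le0// mule0; apply: integral0_eq => s _; congr EFin.
  have [sr|rs] := leP s r; first by rewrite (tpow0 b) ?subr_le0// mulr0.
  by rewrite tpow0 ?mul0r// subr_le0 (le_trans tr)// ltW.
have c0 : 0 < t - r by rewrite subr_gt0.
rewrite (@ge0_integral_affine R (t - r) r)//; last 2 first.
- by apply/measurable_EFinP; exact: conv_measurable.
- by move=> x; rewrite lee_fin mulr_ge0 ?tpow_ge0.
have E x : tpow a (t - ((t - r) * x + r)) * tpow b ((t - r) * x + r - r) =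
    ((t - r) `^ (a - 1) * (t - r) `^ (b - 1)) * (tpow a (1 - x) * tpow b (x - 0)).
  have -> : t - ((t - r) * x + r) = (t - r) * (1 - x) by ring.
  have -> : (t - r) * x + r - r = (t - r) * (x - 0) by ring.
  by rewrite !tpowM//; ring.
under eq_integral do rewrite E EFinM.
rewrite ge0_integralZl//; last 3 first.
- by apply/measurable_EFinP; exact: conv_measurable.
- by move=> x _; rewrite lee_fin mulr_ge0 ?tpow_ge0.
- by rewrite lee_fin mulr_ge0 ?powR_ge0.
rewrite muleA -EFinM muleC; congr (_ * _%:E)%E.
rewrite tpowE// mulrA -{1}[t - r]powRr1 ?ltW// -!powRD ?(gt_eqF c0) ?implybT//.
by congr (_ `^ _); ring.
Qed.

(* The beta integral B: integrating [tpow a (w - v) * tpow b v * exp (- w)] first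
   in [v] gives [B * Gamma (a + b)], first in [w] gives [Gamma a * Gamma b]. *)
Let tpow_beta a b : 0 < a -> 0 < b ->
  (\int[mu]_s (tpow a (1 - s) * tpow b (s - 0))%:E =
   (Gamma a * Gamma b / Gamma (a + b))%:E)%E.
Proof.
move=> a0 b0; have ab0 : 0 < a + b by rewrite addr_gt0.
set B := (X in X = _).
suff : (B * (Gamma (a + b))%:E = (Gamma a * Gamma b)%:E)%E.
  have G0 : Gamma (a + b) != 0 by rewrite gt_eqF ?Gamma_gt0.
  move=> BG; rewrite EFinM -BG -muleA -EFinM divff// mule1//.
pose h (z : measurableTypeR R * measurableTypeR R) : \bar R :=
  (tpow a (z.1 - z.2) * tpow b (z.2 - 0) * expR (- z.1))%:E.
have h0 z : (0 <= h z)%E by rewrite lee_fin !mulr_ge0 ?tpow_ge0 ?expR_ge0.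
have mh : measurable_fun setT h.
  apply/measurable_EFinP; apply: measurable_funM; first apply: measurable_funM.
  - apply: (measurableT_comp (measurable_tpow _)); exact: measurable_funB.
  - apply: (measurableT_comp (measurable_tpow _)); exact: measurable_funB.
  - apply: measurableT_comp => //; exact: measurable_funN.
have := @fubini_tonelli _ _ _ _ R mu mu h mh h0.
have -> : (\int[mu]_w \int[mu]_v h (w, v) = B * (Gamma (a + b))%:E)%E.
  rewrite -GammaE// -ge0_integralZl//; last 3 first.
  - by apply/measurable_EFinP; exact: measurable_gamma_density.
  - by move=> x _; rewrite lee_fin gamma_density_ge0.
  - by apply: integral_ge0 => x _; rewrite lee_fin mulr_ge0 ?tpow_ge0.
  apply: eq_integral => w _; rewrite /h/=.
  under eq_integral do rewrite mulrC EFinM.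
  rewrite ge0_integralZl//; last 2 first.
  - by apply/measurable_EFinP; exact: conv_measurable.
  - by move=> x _; rewrite lee_fin mulr_ge0 ?tpow_ge0.
  by rewrite tpow_conv_scale -/B subr0 muleCA -EFinM mulrC.
move=> ->; rewrite EFinM -!GammaE// -ge0_integralZl//; last 3 first.
- by apply/measurable_EFinP; exact: measurable_gamma_density.
- by move=> x _; rewrite lee_fin gamma_density_ge0.
- by apply: integral_ge0 => x _; rewrite lee_fin gamma_density_ge0.
apply: eq_integral => v _; rewrite /h/= muleC.
rewrite (@ge0_integral_affine R 1 v)//; last 2 first.
- apply/measurable_EFinP; apply: measurable_funM; first apply: measurable_funM => //.
    by apply: (measurableT_comp (measurable_tpow _)); exact: measurable_funB.
  by apply: measurableT_comp.
- by move=> x; rewrite lee_fin !mulr_ge0 ?tpow_ge0 ?expR_ge0.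
rewrite mul1e -ge0_integralZl//; last 3 first.
- by apply/measurable_EFinP; exact: measurable_gamma_density.
- by move=> x _; rewrite lee_fin gamma_density_ge0.
- by rewrite lee_fin gamma_density_ge0.
apply: eq_integral => x _; rewrite -EFinM /gamma_density; congr EFin.
by rewrite mul1r addrK subr0 opprD expRD; ring.
Qed.

(** Euler's beta integral in its invariant form: the kernels are a semigroup under
    convolution. *)
Lemma frac_kernel_conv a b r t : 0 < a -> 0 < b ->
  (\int[mu]_s (frac_kernel a (t - s) * frac_kernel b (s - r))%:E =
   (frac_kernel (a + b) (t - r))%:E)%E.
Proof.
move=> a0 b0.
have E s : (frac_kernel a (t - s) * frac_kernel b (s - r))%:E =
   ((Gamma a * Gamma b)^-1%:E * (tpow a (t - s) * tpow b (s - r))%:E)%E.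
  by rewrite -EFinM /frac_kernel invfM; congr EFin; ring.
under eq_integral do rewrite E.
rewrite ge0_integralZl//; last 3 first.
- by apply/measurable_EFinP; exact: conv_measurable.
- by move=> x _; rewrite lee_fin mulr_ge0 ?tpow_ge0.
- by rewrite lee_fin invr_ge0 mulr_ge0// ltW// Gamma_gt0.
rewrite tpow_conv_scale tpow_beta// -!EFinM; congr EFin; rewrite /frac_kernel.
have G0 : Gamma a * Gamma b != 0 by rewrite mulf_neq0// gt_eqF// Gamma_gt0.
by rewrite [X in _ * X]mulrAC -[X in _ * X]mulrA mulKf.
Qed.

Lemma frac_kernel_conv_integrable a b r t : 0 < a -> 0 < b ->
  mu.-integrable setT (fun s => (frac_kernel a (t - s) * frac_kernel b (s - r))%:E).
Proof.
move=> a0 b0; apply/integrableP; split.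
  apply/measurable_EFinP; apply: measurable_funM;
    apply: (measurableT_comp (measurable_frac_kernel _)); exact: measurable_funB.
have E s : (`|(frac_kernel a (t - s) * frac_kernel b (s - r))%:E| =
    (frac_kernel a (t - s) * frac_kernel b (s - r))%:E)%E.
  by rewrite /= ger0_norm// mulr_ge0 ?frac_kernel_ge0.
under eq_integral do rewrite E.
by rewrite frac_kernel_conv// ltry.
Qed.

End GammaFunction.

(** * Riemann-Liouville integrals as convolutions *)

Section RLIntegral.
Context {R : realType}.
Implicit Types (a b r s t : R) (g : R -> R).
Local Notation mu := (@lebesgue_measure R).

Let frac_kernel2_ge0 a b x y : 0 < a -> 0 < b -> 0 <= frac_kernel a x * frac_kernel b y.
Proof. by move=> a0 b0; apply: mulr_ge0; exact: frac_kernel_ge0. Qed.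

(** The integrand of [I^a g t] with its normalisation, extended by 0 to the line so
    that orders can be compared and composed under one integral over [setT]. *)
Definition rl_conv a g t : R -> R := fun s => frac_kernel a (t - s) * (g \_ `]0, t[) s.

Lemma RL_kernelE a g t s : 0 < a -> 0 < s < t ->
  RL_kernel a g t s = Gamma a * rl_conv a g t s.
Proof.
move=> a0 /andP[s0 st].
rewrite /rl_conv patchE ifT; last by rewrite inE/= in_itv/= s0 st.
rewrite /RL_kernel /frac_kernel tpowE ?subr_gt0// mulrA; congr (_ * _).
by rewrite mulrC divfK// gt_eqF// Gamma_gt0.
Qed.

Lemma rl_conv_out a g t s : s \notin `]0, t[ -> rl_conv a g t s = 0.
Proof.
move=> st; rewrite /rl_conv patchE ifF ?mulr0//.
by apply/negP; rewrite inE/=; exact/negP.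
Qed.

Lemma rl_conv_patch a g t : 0 < a ->
  (EFin \o rl_conv a g t) =
  (fun s => ((Gamma a)^-1)%:E * (RL_kernel a g t s)%:E)%E \_ `]0, t[.
Proof.
move=> a0; apply/funext => s; rewrite patchE; case: ifPn.
  rewrite inE/= in_itv/= => st; rewrite RL_kernelE// -EFinM mulrA mulVf ?mul1r//.
  by rewrite gt_eqF// Gamma_gt0.
move=> st; rewrite /= rl_conv_out//; apply: contraNN st.
by rewrite inE/=.
Qed.

Lemma RL_integrableP a g t : 0 < a ->
  RL_integrable a g t <-> mu.-integrable setT (EFin \o rl_conv a g t).
Proof.
move=> a0; rewrite rl_conv_patch//.
have G0 : Gamma a != 0 by rewrite gt_eqF// Gamma_gt0.
split => [/(_ (lt0r_neq0 a0)) ig|].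
  by apply/integrable_restrict => //; rewrite setTI; apply: integrableZl.
move=> /integrable_restrict; rewrite setTI => /(_ (measurable_itv _) measurableT) ig _.
have := @integrableZl _ _ R mu _ (measurable_itv _) (Gamma a) _ ig.
apply: eq_integrable => //= s _.
by rewrite -!EFinM mulrA divff// mul1r.
Qed.

Lemma RL_integralE a g t : 0 < a -> RL_integrable a g t ->
  ((RL_integral a g t)%:E = \int[mu]_s (rl_conv a g t s)%:E)%E.
Proof.
move=> a0 ig.
have ig' := ig (lt0r_neq0 a0).
rewrite /RL_integral (negbTE (lt0r_neq0 a0)).
under [RHS]eq_integral do rewrite -[_%:E]/((EFin \o _) _) rl_conv_patch//.
rewrite -integral_mkcond integralZl// EFinM; congr (_ * _)%E.
by rewrite /Rintegral fineK//; exact: integrable_fin_num.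
Qed.

Lemma RL_integral_eq a g1 g2 t : 0 < t -> (forall s, 0 < s <= t -> g1 s = g2 s) ->
  RL_integral a g1 t = RL_integral a g2 t.
Proof.
move=> t0 e; rewrite /RL_integral; case: ifP => _; first by rewrite e// t0 lexx.
congr (_ * _); apply: eq_Rintegral => s; rewrite inE/= in_itv/= => /andP[s0 st].
by rewrite /RL_kernel e// s0 ltW.
Qed.

Lemma RL_integrable_eq a g1 g2 t : (forall s, 0 < s < t -> g1 s = g2 s) ->
  RL_integrable a g1 t -> RL_integrable a g2 t.
Proof.
move=> e ig a0; have := ig a0; apply: eq_integrable => //= s.
by rewrite inE/= in_itv/= => st; rewrite /RL_kernel e.
Qed.

(** Multiplying the integrand by the opposite power of [t - s] recovers [g]. *)
Lemma RL_integrable_measurable a g t : 0 < a -> RL_integrable a g t ->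
  measurable_fun `]0, t[ g.
Proof.
move=> a0 /(_ (lt0r_neq0 a0)) /measurable_int /measurable_EFinP mk.
apply: (@eq_measurable_fun _ _ _ _ _ (fun s => (tpow (1 - (a - 1)) (t - s)) * RL_kernel a g t s)).
  move=> s; rewrite inE/= in_itv/= => /andP[s0 st].
  rewrite /RL_kernel tpowE ?subr_gt0// mulrA -powRD; last first.
    by rewrite subr_eq0 (gt_eqF st) implybT.
  have -> : 1 - (a - 1) - 1 + (a - 1) = 0 by ring.
  by rewrite powRr0 mul1r.
apply: measurable_funM => //; apply: measurable_funTS.
by apply: (measurableT_comp (measurable_tpow _)); exact: measurable_funB.
Qed.

Lemma frac_kernel_le a b t s : 0 < a -> 0 < b -> 0 < s <= t ->
  frac_kernel (a + b) s <= Gamma b / Gamma (a + b) * t `^ a * frac_kernel b s.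
Proof.
move=> a0 b0 /andP[s0 st]; have ab0 : 0 < a + b by rewrite addr_gt0.
have Gb := Gamma_gt0 b0; have Gab := Gamma_gt0 ab0.
rewrite /frac_kernel !tpowE//.
have -> : s `^ (a + b - 1) = s `^ a * s `^ (b - 1).
  by rewrite -powRD ?(gt_eqF s0) ?implybT// addrA.
have -> : Gamma b / Gamma (a + b) * t `^ a * (s `^ (b - 1) / Gamma b) =
   t `^ a * s `^ (b - 1) / Gamma (a + b).
  have -> : Gamma b / Gamma (a + b) * t `^ a * (s `^ (b - 1) / Gamma b) =
     (Gamma b / Gamma b) * (t `^ a * s `^ (b - 1) / Gamma (a + b)) by ring.
  by rewrite divff ?mul1r// gt_eqF.
apply: ler_wpM2r; first by rewrite invr_ge0 ltW.
apply: ler_wpM2r; first exact: powR_ge0.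
by rewrite ge0_ler_powR ?nnegrE// ltW// (lt_le_trans s0).
Qed.

Lemma measurable_rl_conv a g t : measurable_fun `]0, t[ g ->
  measurable_fun setT (rl_conv a g t).
Proof.
move=> mg; apply: measurable_funM.
  by apply: (measurableT_comp (measurable_frac_kernel _)); exact: measurable_funB.
by apply/measurable_restrict => //; rewrite setTI.
Qed.

(** On ]0, t[ the kernel of order [a + b] is at most a constant times that of order
    [b], so raising the order preserves integrability. *)
Lemma RL_integrableD a b g t : 0 < a -> 0 < b -> 0 < t ->
  RL_integrable b g t -> RL_integrable (a + b) g t.
Proof.
move=> a0 b0 t0 ig; have ab0 : 0 < a + b by rewrite addr_gt0.
have mg := RL_integrable_measurable b0 ig.
move/(RL_integrableP _ _ b0) : ig => ig; apply/(RL_integrableP _ _ ab0).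
have igz := @integrableZl _ _ R mu _ measurableT (Gamma b / Gamma (a + b) * t `^ a) _ ig.
apply: le_integrable igz => //; first by apply/measurable_EFinP; exact: measurable_rl_conv.
move=> s _ /=; rewrite lee_fin.
have [st|st] := boolP (s \in `]0, t[); last by rewrite !rl_conv_out// mulr0.
move: (st); rewrite in_itv/= => /andP[s0 s1].
rewrite [leRHS]normrM [X in _ <= X * _]ger0_norm; last first.
  by rewrite !mulr_ge0 ?invr_ge0 ?powR_ge0// ltW// Gamma_gt0.
rewrite /rl_conv 2![`|frac_kernel _ _ * _|]normrM mulrA; apply: ler_wpM2r => //.
rewrite !ger0_norm ?frac_kernel_ge0//.
by apply: frac_kernel_le => //; rewrite subr_gt0 s1 gerBl ltW.
Qed.

Lemma RL_integral0 g t : RL_integral 0 g t = g t.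
Proof. by rewrite /RL_integral eqxx. Qed.

Lemma RL_integral1 g t : RL_integral 1 g t = \int[mu]_(s in `]0, t[) g s.
Proof.
rewrite /RL_integral oner_eq0 Gamma1 invr1 mul1r; apply: eq_Rintegral => s _.
by rewrite /RL_kernel subrr powRr0 mul1r.
Qed.

Lemma RL_integrable1 g t : RL_integrable 1 g t <->
  mu.-integrable `]0, t[ (EFin \o g).
Proof.
have E : RL_kernel 1 g t = g.
  by apply/funext => s; rewrite /RL_kernel subrr powRr0 mul1r.
by rewrite /RL_integrable E; split => [|//]; apply; exact: oner_neq0.
Qed.

Section semigroup.
Variables (a b t : R) (g : R -> R).
Hypotheses (a0 : 0 < a) (b0 : 0 < b) (t0 : 0 < t).
Hypothesis ig : forall s, 0 < s <= t -> RL_integrable b g s.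

Let ab0 : 0 < a + b. Proof. by rewrite addr_gt0. Qed.
Let igt : RL_integrable b g t. Proof. by apply: ig; rewrite t0 lexx. Qed.
Let mg : measurable_fun `]0, t[ g. Proof. exact: RL_integrable_measurable igt. Qed.
Let igab : RL_integrable (a + b) g t. Proof. exact: RL_integrableD. Qed.

(* Integrating [h] in the second variable yields the integrand of [I^a (I^b g)],
   and in the first, by [frac_kernel_conv], that of [I^(a+b) g]. *)
Let h (z : measurableTypeR R * measurableTypeR R) : \bar R :=
  (frac_kernel a (t - z.1) * frac_kernel b (z.1 - z.2) * (g \_ `]0, t[) z.2)%:E.

Let mh : measurable_fun setT h.
Proof.
apply/measurable_EFinP; apply: measurable_funM; first apply: measurable_funM.
- by apply: (measurableT_comp (measurable_frac_kernel _)); exact: measurable_funB.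
- by apply: (measurableT_comp (measurable_frac_kernel _)); exact: measurable_funB.
- apply: (@measurableT_comp _ _ _ _ _ _ (g \_ `]0, t[) _ snd) => //.
  by apply/measurable_restrict => //; rewrite setTI.
Qed.

Let inner1 (s : R) :
  (\int[mu]_r h (s, r) = (rl_conv a (RL_integral b g) t s)%:E)%E.
Proof.
have [st|st] := boolP (s \in `]0, t[); last first.
  rewrite rl_conv_out//; apply: integral0_eq => r _; rewrite /h/=; congr EFin.
  move: st; rewrite in_itv/= negb_and -!leNgt => /orP[s0|ts]; last first.
    by rewrite frac_kernel_le0 ?mul0r// subr_le0.
  have [sr|rs] := leP s r; first by rewrite (@frac_kernel_le0 _ b) ?subr_le0// mulr0 mul0r.
  rewrite patchE ifF ?mulr0//; apply/negP; rewrite inE/= in_itv/= => /andP[r0 _].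
  by have := lt_le_trans (lt_trans r0 rs) s0; rewrite ltxx.
move: (st); rewrite in_itv/= => /andP[s0 s1].
have igs : RL_integrable b g s by apply: ig; rewrite s0 ltW.
rewrite /rl_conv patchE ifT; last by rewrite inE.
rewrite EFinM RL_integralE// -integralZl//; last exact/RL_integrableP.
apply: eq_integral => r _; rewrite /h/= -EFinM -mulrA; congr (_ * _)%:E.
rewrite /rl_conv; have [sr|rs] := leP s r; first by rewrite frac_kernel_le0 ?subr_le0// !mul0r.
congr (_ * _); rewrite !patchE; congr (if _ then _ else _).
by apply/idP/idP; rewrite !inE/= !in_itv/= => /andP[r0 _]; rewrite r0// (lt_trans rs).
Qed.

Let inner2_abs (r : R) :
  (\int[mu]_s `|h (s, r)| = `|(rl_conv (a + b) g t r)%:E|)%E.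
Proof.
have E s : (`|h (s, r)| = `|(g \_ `]0%R, t[) r|%:E *
    (frac_kernel a (t - s) * frac_kernel b (s - r))%:E)%E.
  rewrite -EFinM; congr EFin.
  by rewrite /= normrM [`|frac_kernel _ _ * _|]ger0_norm ?frac_kernel2_ge0// mulrC.
under eq_integral do rewrite E.
rewrite ge0_integralZl//; last 2 first.
- apply/measurable_EFinP; apply: measurable_funM;
    apply: (measurableT_comp (measurable_frac_kernel _)); exact: measurable_funB.
- by move=> s _; rewrite lee_fin mulr_ge0 ?frac_kernel_ge0.
by rewrite frac_kernel_conv// -EFinM /= /rl_conv [in RHS]normrM mulrC ger0_norm ?frac_kernel_ge0.
Qed.

Let inner2 (r : R) : (\int[mu]_s h (s, r) = (rl_conv (a + b) g t r)%:E)%E.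
Proof.
have E s : (h (s, r) = ((g \_ `]0%R, t[) r)%:E *
    (frac_kernel a (t - s) * frac_kernel b (s - r))%:E)%E.
  by rewrite /h/= EFinM muleC.
under eq_integral do rewrite E.
rewrite integralZl//; first by rewrite frac_kernel_conv// -EFinM mulrC.
exact: frac_kernel_conv_integrable.
Qed.

Let ih : (mu \x mu)%E.-integrable setT h.
Proof.
apply/integrable21ltyP => //.
under eq_integral do rewrite inner2_abs.
by have /(RL_integrableP _ _ ab0)/integrableP[] := igab.
Qed.

(** Absolute integrability on the plane comes from the order [a + b]; it implies the
    existence of the iterated integral without any assumption on [I^b g]. *)
Lemma RL_semigroup_integrable : RL_integrable a (RL_integral b g) t.
Proof.
apply/RL_integrableP => //; have := integrable_fubini_F ih.
by apply: eq_integrable => //= s _; rewrite /fubini_F inner1.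
Qed.

Lemma RL_semigroup :
  RL_integral a (RL_integral b g) t = RL_integral (a + b) g t.
Proof.
apply: EFin_inj; rewrite !RL_integralE//; last exact: RL_semigroup_integrable.
under eq_integral do rewrite -inner1.
under [RHS]eq_integral do rewrite -inner2.
exact: Fubini.
Qed.

End semigroup.

End RLIntegral.

(** * The fundamental theorem of calculus for differentiable functions *)

Section FTCDerivable.
Context {R : realType}.
Local Notation mu := (@lebesgue_measure R).

(** The supremum of the points [t] with [psi a <= psi t] is itself such a point, and
    cannot lie below [b]. *)
Lemma locally_nondecreasing_le (psi : R -> R) (a b : R) : a <= b ->
  (forall x, a <= x <= b -> exists2 d, 0 < d & forall y, a <= y <= b ->
     (x - d < y <= x -> psi y <= psi x) /\ (x <= y < x + d -> psi x <= psi y)) ->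
  psi a <= psi b.
Proof.
move=> ab H.
pose S := [set t | a <= t <= b /\ psi a <= psi t].
have Sa : S a by split; rewrite ?lexx ?ab.
have hS : has_sup S by split; [exists a|exists b => t [/andP[]]].
pose c := sup S.
have ac : a <= c by exact: ub_le_sup hS.2 _ Sa.
have cb : c <= b by apply: ge_sup; [exists a|move=> t [/andP[]]].
have cab : a <= c <= b by rewrite ac cb.
have [d d0 Hd] := H c cab.
have Sc : psi a <= psi c.
  have [t [tab at_] ct] := sup_adherent d0 hS.
  have tc : t <= c by apply: ub_le_sup hS.2 _ _; split.
  apply: le_trans at_ _; apply: (Hd t tab).1.
  by rewrite ct tc.
have [->//|cb'] := eqVneq b c.
have {}cb' : c < b by rewrite lt_neqAle eq_sym cb' cb.
pose y := Num.min b (c + d / 2).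
have cy : c < y by rewrite /y lt_min cb' ltrDl divr_gt0.
have yb : y <= b by rewrite /y ge_min lexx.
have yd : y < c + d.
  by rewrite /y gt_min ltrD2l ltr_pdivrMr// ltr_pMr// ltr1n orbT.
have yab : a <= y <= b by rewrite yb (le_trans ac)// ltW.
have Sy : S y.
  split => //; apply: le_trans Sc _; apply: (Hd y yab).2.
  by rewrite yd ltW.
have := ub_le_sup hS.2 Sy; rewrite -/c leNgt cy //.
Qed.

Lemma derive1_lt_increment (F : R -> R) (x K : R) : derivable F x 1 -> derive1 F x < K ->
  exists2 d, 0 < d & forall y,
    (x - d < y <= x -> F x - F y <= K * (x - y)) /\
    (x <= y < x + d -> F y - F x <= K * (y - x)).
Proof.
move=> dF FK.
have cF : h^-1 *: (F (h + x) - F x) @[h --> 0^'] --> derive1 F x.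
  move: dF; rewrite derive1E /derivable => /cvg_ex[l hl].
  have E : (fun h : R => h^-1 *: ((F \o shift x) (h *: 1) - F x)) =
     (fun h : R => h^-1 *: (F (h + x) - F x)).
    by apply/funext => h /=; rewrite [h *: 1]mulr1.
  rewrite /derive; move: hl; rewrite E => hl.
  by rewrite (cvg_lim _ hl).
have := @cvgr_lt _ _ _ (dnbhs_filter (0 : R)) _ _ cF _ FK.
move=> /nbhs_ballP[d /= d0 Hd]; exists d => // y.
have key : `|y - x| < d -> y != x -> (y - x)^-1 * (F y - F x) < K.
  move=> yd yx; have := Hd (y - x); rewrite /ball/= sub0r normrN subr_eq0 => /(_ yd yx).
  by rewrite subrK.
have [->|yx] := eqVneq y x; first by rewrite !subrr mulr0 lexx.
split => /andP[h1 h2].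
- have {}h2 : y < x by rewrite lt_neqAle yx.
  have /key/(_ yx) : `|y - x| < d by rewrite ltr0_norm ?subr_lt0// opprB; lra.
  have yx0 : y - x < 0 by rewrite subr_lt0.
  rewrite mulrC ltr_ndivrMr// => h3; lra.
- have {}h1 : x < y by rewrite lt_neqAle eq_sym yx.
  have /key/(_ yx) : `|y - x| < d by rewrite gtr0_norm ?subr_gt0//; lra.
  have yx0 : 0 < y - x by rewrite subr_gt0.
  rewrite mulrC ltr_pdivrMr// => h3; lra.
Qed.

Let lebesgue_measure_itvcc (a b : R) : a <= b -> mu `[a, b] = (b - a)%:E.
Proof.
rewrite lebesgue_measure_itv/= lte_fin le_eqVlt => /predU1P[->|->].
  by rewrite ltxx subrr.
by rewrite EFinB.
Qed.

Lemma integrable_itv_cst (a b c : R) : mu.-integrable `[a, b] (EFin \o cst c).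
Proof.
apply: continuous_compact_integrable; first exact: segment_compact.
by apply: continuous_subspaceT => x; exact: cvg_cst.
Qed.

(** If near each [x] the majorant [u] stays above some [K > F' x], then [F] grows more
    slowly than the primitive of [u] on both sides of [x]; the primitive minus [F] is
    locally nondecreasing, hence nondecreasing. *)
Lemma increment_le_integral_majorant (F : R -> R) (u : R -> \bar R) (a b : R) : a <= b ->
  (forall x, a <= x <= b -> derivable F x 1) ->
  measurable_fun setT u -> (forall x, 0 <= u x)%E ->
  (\int[mu]_(x in `[a, b]) u x < +oo)%E ->
  (forall x, a <= x <= b -> exists2 K, 0 <= K /\ derive1 F x < K &
     exists2 d, 0 < d & forall y, x - d < y < x + d -> a <= y <= b -> (K%:E <= u y)%E) ->
  ((F b - F a)%:E <= \int[mu]_(x in `[a, b]) u x)%E.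
Proof.
move=> ab dF mu_ u0 uoo H.
pose phi t := fine (\int[mu]_(x in `[a, t]) u x)%E.
have phiE t : t <= b -> (\int[mu]_(x in `[a, t]) u x = (phi t)%:E)%E.
  move=> tb; rewrite /phi fineK// ge0_fin_numE ?integral_ge0//.
  apply: le_lt_trans uoo; apply: ge0_subset_integral => //.
  - exact: measurable_funTS.
  - exact: subset_itvl.
have phi_diff x y K : a <= x -> x <= y -> y <= b ->
    (forall z, x < z <= y -> (K%:E <= u z)%E) -> 0 <= K -> K * (y - x) <= phi y - phi x.
  move=> ax xy yb Ku K0.
  have E : (\int[mu]_(z in `[a, y]) u z =
      \int[mu]_(z in `[a, x]) u z + \int[mu]_(z in `]x, y]) u z)%E.
    rewrite (@itv_bndbnd_setU _ _ _ (BRight x)) ?bnd_simp//.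
    rewrite ge0_integral_setU//; first exact: measurable_funTS.
    by apply/disj_setPS => z [/=]; rewrite !in_itv/= => /andP[_ zx] /andP[]; rewrite ltNge zx.
  have L : ((K * (y - x))%:E <= \int[mu]_(z in `]x, y]) u z)%E.
    apply: (@le_trans _ _ (\int[mu]_(z in `]x, y]) K%:E)%E).
      rewrite integral_cst//= lebesgue_measure_itv/= lte_fin.
      have [xy'|yx] := ltP x y; first by rewrite -EFinB -EFinM.
      by have /eqP -> : y == x by [rewrite eq_le yx xy]; rewrite subrr mulr0 mule0.
    apply: ge0_le_integral => //; first exact: measurable_funTS.
  have := leeD2l (\int[mu]_(z in `[a, x]) u z)%E L.
  rewrite -E phiE ?(le_trans xy)// phiE// -EFinD lee_fin; lra.
have := @locally_nondecreasing_le (fun t => phi t - F t) a b ab.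
have phia : phi a = 0 by rewrite /phi set_itv1 integral_set1.
rewrite phiE// lee_fin phia => Hl.
suff : 0 - F a <= phi b - F b by lra.
apply: Hl => x xab.
have [K [K0 FK] [d1 d10 Hd1]] := H x xab.
have [d2 d20 Hd2] := derive1_lt_increment (dF _ xab) FK.
exists (Num.min d1 d2) => [|y yab]; first by rewrite lt_min d10.
have [Hl Hr] := Hd2 y; move/andP: xab => [ax xb]; move/andP: yab => [ay yb].
have m1 : Num.min d1 d2 <= d1 by rewrite ge_min lexx.
have m2 : Num.min d1 d2 <= d2 by rewrite ge_min lexx orbT.
split => /andP[h1 h2].
- have /Hl h3 : x - d2 < y <= x by rewrite h2 andbT; lra.
  have : K * (x - y) <= phi x - phi y.
    apply: phi_diff => // z /andP[yz zx]; apply: Hd1.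
      by apply/andP; split; lra.
    by apply/andP; split; lra.
  lra.
- have /Hr h3 : x <= y < x + d2 by rewrite h1 /=; lra.
  have : K * (y - x) <= phi y - phi x.
    apply: phi_diff => // z /andP[xz zy]; apply: Hd1.
      by apply/andP; split; lra.
    by apply/andP; split; lra.
  lra.
Qed.

(** The hypothesis of [increment_le_integral_majorant] asks for a kind of lower
    semicontinuity.  A majorant with that property and almost the integral of [g] is
    built as follows.  Cut [a, b] into the level sets [E k] where [g] lies between
    [k e] and [(k+1) e], enclose each in an open [U k] with [mu (U k \ E k)] so small
    that the functions [(k+1) e] on [U k \ E k] have total integral at most [e], and
    add those functions to [g + e].  On [U k], a neighbourhood of each point of [E k],
    the sum is at least [(k+1) e]: through [g + e] on [E k], and through the added
    function elsewhere. *)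
Lemma increment_le_integral (F g : R -> R) (a b : R) : a <= b ->
  (forall x, a <= x <= b -> derivable F x 1) ->
  measurable_fun setT g -> (forall x, 0 <= g x) ->
  mu.-integrable `[a, b] (EFin \o g) ->
  (forall x, a <= x <= b -> derive1 F x <= g x) ->
  F b - F a <= \int[mu]_(x in `[a, b]) g x.
Proof.
move=> ab dF mg g0 ig Fg.
(* The error is [e * (b - a)] from the constant and [e] from the open sets. *)
suff main e : 0 < e -> F b - F a <= \int[mu]_(x in `[a, b]) g x + e * (b - a) + e.
  apply/ler_addgt0Pr => e e0.
  have d0 : 0 < b - a + 1 by lra.
  have := main (e / (b - a + 1)) (divr_gt0 e0 d0).
  rewrite -addrA; congr (_ <= _ + _).
  by field; rewrite gt_eqF.
move=> e0.
pose E (k : nat) : set R := `[a, b] `&` [set x | k%:R * e <= g x < k.+1%:R * e].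
have mE k : measurable (E k).
  apply: measurableI => //.
  rewrite [X in measurable X](_ : _ = setT `&` g @^-1` `[k%:R * e, k.+1%:R * e[).
    exact: mg.
  by apply/seteqP; split => x /=; rewrite in_itv/= => // -[].
have Efin k : (mu (E k) < +oo)%E.
  apply: (@le_lt_trans _ _ (mu `[a, b])).
    apply: le_measure; rewrite ?inE; [exact: mE|exact: measurable_itv|].
    exact: subIsetl.
  by rewrite lebesgue_measure_itv/=; case: ifPn => //; rewrite -EFinB ltry.
pose K (k : nat) := k.+1%:R * e.
have K0 k : 0 < K k by rewrite mulr_gt0.
have /choice[U HU] : forall k, exists U : set R, [/\ open U, E k `<=` U &
    (mu (U `\` E k) < (e / (2 ^ k.+1)%:R / K k)%:E)%E].
  move=> k; apply: lebesgue_regularity_outer => //.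
    exact: Efin.
  by rewrite !divr_gt0// ltr0n expn_gt0.
have mUE k : measurable (U k `\` E k).
  apply: measurableD => //; apply: open_measurable; by case: (HU k).
pose v x : \bar R := (\sum_(k <oo) (K k * \1_(U k `\` E k) x)%:E)%E.
have v1 k x : (0 <= (K k * \1_(U k `\` E k) x)%:E)%E.
  by rewrite lee_fin mulr_ge0// ltW.
have v0 x : (0 <= v x)%E by exact: nneseries_ge0.
have mv1 k : measurable_fun setT (fun x => (K k * \1_(U k `\` E k) x)%:E).
  by apply/measurable_EFinP; apply: measurable_funM => //; exact: measurable_indic.
have mv : measurable_fun setT v.
  exact: ge0_emeasurable_sum.
have iv : (\int[mu]_(x in `[a, b]) v x <= e%:E)%E.
  rewrite integral_nneseries//; last by move=> k; exact: (measurable_funTS (mv1 k)).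
  apply: le_trans (epsilon_trick0 xpredT (ltW e0)).
  apply: lee_nneseries => [k _ _|k _]; first exact: integral_ge0.
  under eq_integral do rewrite EFinM.
  rewrite ge0_integralZl//; last 2 first.
  - by apply/measurable_EFinP; apply: measurable_indic; exact: mUE.
  - by rewrite lee_fin ltW.
  rewrite integral_indic//.
  apply: (@le_trans _ _ ((K k)%:E * (e / (2 ^ k.+1)%:R / K k)%:E)%E).
    apply: lee_wpmul2l; first by rewrite lee_fin ltW.
    have [_ _ /ltW] := HU k; apply: le_trans.
    apply: le_measure; rewrite ?inE; [|exact: mUE|exact: subIsetl].
    by apply: measurableI; [exact: mUE|exact: measurable_itv].
    by rewrite -EFinM lee_fin [_ * (_ / K k)]mulrC divfK// gt_eqF.
  exact: mUE.
pose u x := ((g x + e)%:E + v x)%E.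
have mge : measurable_fun setT (fun x => (g x + e)%:E).
  by apply/measurable_EFinP; exact: measurable_funD.
have mu_ : measurable_fun setT u by exact: emeasurable_funD.
have ge0 x : (0 <= (g x + e)%:E)%E by rewrite lee_fin addr_ge0// ltW.
have u0 x : (0 <= u x)%E by exact: adde_ge0.
have iu : (\int[mu]_(x in `[a, b]) u x <=
   (\int[mu]_(x in `[a, b]) g x + e * (b - a) + e)%:E)%E.
  rewrite ge0_integralD//; last 2 first.
  - exact: measurable_funTS.
  - exact: measurable_funTS.
  rewrite EFinD; apply: leeD => //.
  under eq_integral do rewrite EFinD.
  rewrite integralD//; last first.
    exact: integrable_itv_cst.
  rewrite integral_cst// EFinD; apply: leeD.
    by rewrite /Rintegral fineK//; exact: integrable_fin_num.
  rewrite [X in (_ * X <= _)%E](_ : _ = (b - a)%:E); last exact: lebesgue_measure_itvcc.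
  by rewrite EFinM.
rewrite -lee_fin; apply: (le_trans _ iu).
apply: increment_le_integral_majorant => //.
  by apply: le_lt_trans iu _; exact: ltry.
move=> x xab.
pose k := Num.truncn (g x / e).
have kP : k%:R * e <= g x < k.+1%:R * e.
  by rewrite -ler_pdivlMr// -ltr_pdivrMr// truncn_itv// divr_ge0// ltW.
exists (K k).
  split; first exact: ltW.
  by apply: le_lt_trans (Fg _ xab) _; case/andP: kP.
have [oU EU _] := HU k.
have Ux : U k x by apply: EU; split => //=; rewrite in_itv.
have /nbhs_ballP[d /= d0 Hd] : nbhs x (U k) by exact: open_nbhs_nbhs.
exists d => // y yd yab.
have Uy : U k y by apply: Hd; rewrite /ball/= ltr_distlC.
have [Ey|Ey] := pselect (E k y).
  apply: (@le_trans _ _ (g y + e)%:E); last by rewrite /u leeDl.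
  rewrite lee_fin /K -natr1 mulrDl mul1r lerD2r; by case: Ey => _ /= /andP[].
apply: (@le_trans _ _ (v y)); last by rewrite /u leeDr.
apply: le_trans (nneseries_lim_ge k.+1 _); last by [].
rewrite big_nat_recr//= indicE mem_set// mulr1.
by rewrite leeDr// sume_ge0.
Qed.

(** For a derivative unbounded below, [increment_le_integral] applies to
    [F x + n x] and the truncation [max (F', - n) + n]; dominated convergence then
    removes the truncation. *)
Lemma increment_le_integral_derive1 (F : R -> R) (a b : R) : a <= b ->
  (forall x, a <= x <= b -> derivable F x 1) ->
  mu.-integrable `[a, b] (EFin \o derive1 F) ->
  F b - F a <= \int[mu]_(x in `[a, b]) (derive1 F x).
Proof.
move=> ab dF iG.
pose G := derive1 F.
have mG : measurable_fun `[a, b] G by have /measurable_int/measurable_EFinP := iG.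
pose G_ (n : nat) x := Num.max (G x) (- n%:R).
have mG_ n : measurable_fun `[a, b] (G_ n) by exact: measurable_maxr.
have GG n x : `|G_ n x| <= `|G x|.
  rewrite /G_; have [//|h] := leP (- n%:R) (G x).
  by rewrite normrN ger0_norm// ler0_norm; [lra|apply: le_trans (ltW h) _; rewrite oppr_le0].
have iG_ n : mu.-integrable `[a, b] (EFin \o G_ n).
  apply: le_integrable iG => //.
    by apply/measurable_EFinP; exact: mG_.
  by move=> x _; rewrite /= lee_fin.
have bound n : ((F b - F a)%:E <= \int[mu]_(x in `[a, b]) (G_ n x)%:E)%E.
  pose g := (fun x => G_ n x + n%:R) \_ `[a, b].
  have icst : mu.-integrable `[a, b] (EFin \o cst (n%:R : R)).
    exact: integrable_itv_cst.
  have gE x : a <= x <= b -> g x = G_ n x + n%:R.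
    by move=> xab; rewrite /g patchE ifT// inE/= in_itv.
  have dFn x : a <= x <= b -> is_derive x 1 (fun x => F x + n%:R * x) (G x + n%:R).
    move=> xab; apply: is_deriveD.
      by split; [exact: dF|rewrite /G derive1E].
    have := @is_deriveZ R R R id n%:R x 1 1 (is_derive_id x 1); rewrite [_ *: 1]mulr1.
    exact.
  have := @increment_le_integral (fun x => F x + n%:R * x) g a b ab.
  move=> /(_ _ _ _ _ _) h.
  have {}h : F b + n%:R * b - (F a + n%:R * a) <= \int[mu]_(x in `[a, b]) g x.
    apply: h.
    - by move=> x xab; have [] := dFn x xab.
    - by apply/measurable_restrict => //; rewrite setTI; exact: measurable_funD.
    - move=> x; apply: restrict_ge0 => y _; rewrite /G_.
      by have : - n%:R <= Num.max (G y) (- n%:R) by [rewrite le_max lexx orbT]; lra.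
    - have := integrableD _ (iG_ n) icst => /(_ (measurable_itv _)).
      by apply: eq_integrable => //= x; rewrite inE/= in_itv/= => xab; rewrite gE.
    - move=> x xab; have [_] := dFn x xab; rewrite -derive1E => ->.
      by rewrite gE// lerD2r /G_ le_max lexx.
  have E : \int[mu]_(x in `[a, b]) g x = \int[mu]_(x in `[a, b]) G_ n x + n%:R * (b - a).
    transitivity (\int[mu]_(x in `[a, b]) (G_ n x + n%:R)).
      by apply: eq_Rintegral => x; rewrite inE/= in_itv/= => xab; rewrite gE.
    rewrite RintegralD//; congr (_ + _).
    rewrite Rintegral_cst//; congr (_ * _).
    by rewrite [X in fine X](_ : _ = (b - a)%:E)//; exact: lebesgue_measure_itvcc.
  have : F b - F a <= \int[mu]_(x in `[a, b]) G_ n x by rewrite E in h; lra.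
  rewrite -lee_fin /Rintegral fineK//.
  by apply: integrable_fin_num; [exact: measurable_itv|exact: iG_].
have [_ _ cv] : [/\ mu.-integrable `[a, b] (EFin \o G),
   [sequence (\int[mu]_(x in `[a, b])
     `|(EFin \o G_ n) x - (EFin \o G) x|)%E]_n @ \oo --> 0%E &
   [sequence (\int[mu]_(x in `[a, b]) ((EFin \o G_ n) x))%E]_n @ \oo -->
     (\int[mu]_(x in `[a, b]) (EFin \o G) x)%E].
  apply: (@dominated_convergence _ _ _ mu _ (measurable_itv _) _ _ (abse \o (EFin \o G))).
  - by move=> n; apply/measurable_EFinP; exact: mG_.
  - by apply/measurable_EFinP; exact: mG.
  - apply/aeW => x _; apply: cvg_near_cst; near=> n.
    rewrite /= /G_; congr EFin; apply: max_l.
    rewrite lerNl; apply: le_trans (ler_norm _) _; rewrite normrN.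
    near: n; exact: nbhs_infty_ger.
  - exact: integrable_abse.
  - by apply/aeW => x n _; rewrite /= lee_fin.
rewrite -lee_fin /Rintegral fineK; last exact: integrable_fin_num.
rewrite -(cvg_lim _ cv)//; apply: lime_ge; first by apply/cvg_ex; eexists; exact: cv.
exact: nearW.
Unshelve. all: by end_near. Qed.

(** One inequality for [F] and the same one for [- F].  Continuity of the derivative
    is replaced by its integrability. *)
Lemma Rintegral_derive1 (F : R -> R) (a b : R) : a <= b ->
  (forall x, a <= x <= b -> derivable F x 1) ->
  mu.-integrable `[a, b] (EFin \o derive1 F) ->
  \int[mu]_(x in `[a, b]) (derive1 F x) = F b - F a.
Proof.
move=> ab dF iF; apply/eqP; rewrite eq_le increment_le_integral_derive1// andbT.
have dN x : a <= x <= b -> derive1 (fun x => - F x) x = - derive1 F x.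
  by move=> xab; rewrite derive1N//; exact: dF.
have iN : mu.-integrable `[a, b] (EFin \o derive1 (fun x => - F x)).
  have := integrableN iF; apply: eq_integrable => //= x.
  by rewrite inE/= in_itv/= => xab; rewrite dN.
have := @increment_le_integral_derive1 (fun x => - F x) a b ab.
move=> /(_ (fun x xab => derivableN (dF x xab)) iN).
have -> : \int[mu]_(x in `[a, b]) derive1 (fun x => - F x) x =
   - \int[mu]_(x in `[a, b]) (derive1 F x).
  rewrite -mulN1r -RintegralZl//; apply: eq_Rintegral => x.
  by rewrite inE/= in_itv/= => xab; rewrite dN// mulN1r.
lra.
Qed.

End FTCDerivable.

(** * Mittag-Leffler functions *)

Section EntirePowerSeries.
Context {R : realType}.
Implicit Types (c : nat -> R) (x z : R).

(** Boundedness of [|c k| z^k] for every [z >= 0], which is equivalent to an infinite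
    radius of convergence and is easy to check and to differentiate. *)
Definition entire_coef c :=
  forall z, 0 <= z -> exists K, forall k, `|c k| * z ^+ k <= K.

(** The bound at [2 (|x| + 1)] makes the series at [x] dominated by a geometric series
    of ratio [1/2]. *)
Lemma entire_coef_cvg_norm c x : entire_coef c ->
  cvgn (series (fun k => `|c k * x ^+ k|)).
Proof.
move=> /(_ (2 * (`|x| + 1)) _)[]; first by rewrite mulr_ge0// addr_ge0.
move=> K cK.
apply: (@series_le_cvg R _ (geometric K 2^-1)) => //.
- move=> n; rewrite /= mulr_ge0 ?exprn_ge0 ?invr_ge0//.
  by apply: le_trans (cK 0); rewrite mulr1.
- move=> n; rewrite /= -ler_pdivrMr ?exprn_gt0 ?invr_gt0// exprVn invrK.
  apply: le_trans (cK n); rewrite normrM -mulrA ler_wpM2l// normrX -exprMn mulrC.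
  by rewrite lerXn2r ?nnegrE ?mulr_ge0 ?addr_ge0// ler_wpM2l// lerDl.
- apply: is_cvg_geometric_series; rewrite ger0_norm ?invr_ge0//.
  by rewrite invf_lt1// ltr1n.
Qed.

Lemma entire_coef_cvg c x : entire_coef c -> cvgn (pseries c x).
Proof. by move=> ec; apply: normed_cvg; exact: entire_coef_cvg_norm. Qed.

Lemma entire_coef_diffs c : entire_coef c -> entire_coef (pseries_diffs c).
Proof.
move=> ec z z0; have [] := ec (2 * (z + 1)); first by rewrite mulr_ge0// addr_ge0.
move=> K cK; exists K => k; apply: le_trans (cK k.+1).
rewrite /pseries_diffs normrM normr_nat -mulrA mulrCA ler_wpM2l// exprMn.
apply: ler_pM; rewrite ?exprn_ge0//.
  by rewrite -natrX ler_nat; apply: ltnW; exact: ltn_expl.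
apply: (@le_trans _ _ ((z + 1) ^+ k)).
  by rewrite lerXn2r ?nnegrE ?addr_ge0// lerDl.
by rewrite exprS ler_peMl ?exprn_ge0 ?addr_ge0// lerDr.
Qed.

Lemma entire_coef_continuous c : entire_coef c ->
  continuous (fun x => limn (pseries c x)).
Proof.
move=> ec x; apply: derivable1_continuous.
have x1 : `|x| < `| `|x| + 1| by rewrite [ltRHS]ger0_norm ?addr_ge0// ltrDl.
have ec' := entire_coef_diffs ec.
have [] := @pseries_snd_diffs R c (`|x| + 1) x (entire_coef_cvg ec)
  (entire_coef_cvg ec') (entire_coef_cvg (entire_coef_diffs ec')) x1.
by [].
Qed.

End EntirePowerSeries.

Section MittagLeffler.
Context {R : realType}.
Variable m : R.
Hypothesis m0 : 0 < m.
Implicit Types (a lam d s t x z : R) (k n : nat).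
Local Notation mu := (@lebesgue_measure R).

Definition ml_coef d k : R := (Gamma (m * k%:R + d))^-1.

Let arg_gt0 d k : 0 < d -> 0 < m * k%:R + d.
Proof. by move=> d0; rewrite ltr_wpDl// mulr_ge0// ltW. Qed.

(** [Gamma_ge_pow] with base [(z + 1)^(1/m)] bounds [Gamma (m k + d)] below by a
    constant times [(z + 1)^k]. *)
Lemma ml_coef_entire d : 0 < d -> entire_coef (ml_coef d).
Proof.
move=> d0 z z0; have z1 : 0 < z + 1 by rewrite ltr_wpDl.
pose A := (z + 1) `^ m^-1.
have A0 : 0 < A by rewrite powR_gt0.
have Am : A `^ m = z + 1 by rewrite /A -powRrM mulVf ?gt_eqF// powRr1// ltW.
have B0 : 0 < A `^ d / (A + 1) * expR (- (A + 1)).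
  by rewrite mulr_gt0 ?expR_gt0// divr_gt0 ?powR_gt0// addr_gt0.
exists (A `^ d / (A + 1) * expR (- (A + 1)))^-1 => k.
have G0 : 0 < Gamma (m * k%:R + d) by apply: Gamma_gt0; exact: arg_gt0.
rewrite /ml_coef ger0_norm ?invr_ge0 ?(ltW G0)// mulrC ler_pdivrMr// mulrC ler_pdivlMr//.
have := Gamma_ge_pow (arg_gt0 k d0) A0; apply: le_trans.
rewrite powRD ?(gt_eqF A0) ?implybT// powRrM Am powR_mulrn ?(ltW z1)//.
rewrite -!mulrA; apply: ler_wpM2r.
  by rewrite mulr_ge0 ?powR_ge0// mulr_ge0 ?expR_ge0// invr_ge0 addr_ge0// ltW.
by rewrite lerXn2r ?nnegrE ?addr_ge0// lerDl.
Qed.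

Definition ml_term lam d t k : R := lam ^+ k * frac_kernel (m * k%:R + d) t.

(** The function [t^(d-1) E_{m,d}(lam t^m)] on [0 < t], and 0 elsewhere: a power series
    whose terms are kernels, on which fractional integrals act by shifting [d]. *)
Definition mlf lam d t : R := limn (series (ml_term lam d t)).

Lemma mlf_limE lam d t : mlf lam d t = limn (series (ml_term lam d t)).
Proof. by []. Qed.

Lemma ml_termE lam d t k : 0 < t ->
  ml_term lam d t k = t `^ (d - 1) * (ml_coef d k * (lam * t `^ m) ^+ k).
Proof.
move=> t0; rewrite /ml_term /frac_kernel tpowE// /ml_coef exprMn.
rewrite -[(t `^ m) ^+ k]powR_mulrn ?powR_ge0//.
have -> : m * k%:R + d - 1 = m * k%:R + (d - 1) by ring.
rewrite (@powRD _ t (m * k%:R)) ?(gt_eqF t0) ?implybT//.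
by rewrite [t `^ (m * _)]powRrM; ring.
Qed.

Lemma ml_term_le0 lam d t k : t <= 0 -> ml_term lam d t k = 0.
Proof. by move=> t0; rewrite /ml_term frac_kernel_le0// mulr0. Qed.

Lemma mlf_le0 lam d t : t <= 0 -> mlf lam d t = 0.
Proof.
move=> t0; rewrite /mlf (_ : series _ = cst 0) ?lim_cst//.
apply/funext => n; rewrite /series/=; apply: big1 => k _; exact: ml_term_le0.
Qed.

Lemma mlf_cvg_norm lam d t : 0 < d -> cvgn (series (fun k => `|ml_term lam d t k|)).
Proof.
move=> d0; have [t0|t0] := leP t 0.
  rewrite (_ : series _ = cst 0); first exact: is_cvg_cst.
  by apply/funext => n; rewrite /series/=; apply: big1 => k _; rewrite ml_term_le0// normr0.
rewrite (_ : (fun k => _) = t `^ (d - 1) *: (fun k => `|ml_coef d k * (lam * t `^ m) ^+ k|)).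
  by apply: is_cvg_seriesZ; apply: entire_coef_cvg_norm; exact: ml_coef_entire.
by apply/funext => k; rewrite ml_termE// normrM ger0_norm ?powR_ge0.
Qed.

Lemma mlf_cvg lam d t : 0 < d -> cvgn (series (ml_term lam d t)).
Proof. by move=> d0; apply: normed_cvg; exact: mlf_cvg_norm. Qed.

Lemma mlfE lam d t : 0 < d -> 0 < t ->
  mlf lam d t = t `^ (d - 1) * limn (pseries (ml_coef d) (lam * t `^ m)).
Proof.
move=> d0 t0.
have c := @entire_coef_cvg R (ml_coef d) (lam * t `^ m) (ml_coef_entire d0).
apply/cvg_lim => //.
have -> : series (ml_term lam d t) =
    (fun n => t `^ (d - 1) * pseries (ml_coef d) (lam * t `^ m) n).
  apply/funext => n; rewrite /pseries /series/= mulr_sumr.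
  by apply: eq_bigr => k _; rewrite ml_termE.
by apply: cvgM; [exact: cvg_cst|exact: c].
Qed.

Lemma mittag_leffler2E lam d t : 0 < d -> 0 < t ->
  t `^ (d - 1) * mittag_leffler2 m d (lam * t `^ m) = mlf lam d t.
Proof.
move=> d0 t0; rewrite mlfE//; congr (_ * _).
rewrite /mittag_leffler2 /pseries; congr (lim (series _ @ \oo)).
by apply/funext => k; rewrite mulrC.
Qed.

Lemma mlf_continuous lam d t : 0 < d -> 0 < t -> {for t, continuous (mlf lam d)}.
Proof.
move=> d0 t0.
have c : {for t, continuous (fun t => t `^ (d - 1) * limn (pseries (ml_coef d) (lam * t `^ m)))}.
  have cp a : {for t, continuous (fun t => t `^ a)}.
    by apply: derivable1_continuous; have [] := is_derive1_powR a t0.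
  apply: continuousM; first exact: cp.
  apply: (@continuous_comp _ _ _ (fun t => lam * t `^ m) (fun x => limn (pseries (ml_coef d) x))).
    by apply: continuousM; [exact: cvg_cst|exact: cp].
  by apply: entire_coef_continuous; exact: ml_coef_entire.
rewrite /prop_for /continuous_at mlfE//.
apply: cvg_trans c; apply: near_eq_cvg; near=> y.
by rewrite mlfE//; near: y; exact: lt_nbhsr.
Unshelve. all: by end_near. Qed.

Lemma mlf_recl lam d t : 0 < d -> mlf lam d t = frac_kernel d t + lam * mlf lam (d + m) t.
Proof.
move=> d0; have dm0 : 0 < d + m by rewrite addr_gt0.
have c := @mlf_cvg lam (d + m) t dm0.
apply/cvg_lim => //; rewrite -(cvg_shiftS (series _)).
have -> : [sequence series (ml_term lam d t) n.+1]_n =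
   (fun n => frac_kernel d t + lam * series (ml_term lam (d + m) t) n).
  apply/funext => n; rewrite /= /series/= big_nat_recl// {1}/ml_term mulr0 add0r expr0 mul1r.
  congr (_ + _); rewrite mulr_sumr; apply: eq_bigr => k _.
  rewrite /ml_term exprS mulrA; congr (_ * frac_kernel _ _).
  by rewrite -natr1; ring.
apply: cvgD; first exact: cvg_cst.
by apply: cvgM; [exact: cvg_cst|exact: c].
Qed.

Lemma measurable_mlf lam d : 0 < d -> measurable_fun setT (mlf lam d).
Proof.
move=> d0; apply: (measurable_fun_cvg (h := fun n t => series (ml_term lam d t) n)).
  move=> n; rewrite /series/=; apply: measurable_sum => k.
  by apply: measurable_funM => //; exact: measurable_frac_kernel.
by move=> t _; exact: mlf_cvg.
Qed.

(* For nonnegative terms sum and integral commute; the result is the finite integral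
   that dominates the signed series. *)
Let mlf_abs_integral lam d a t : 0 < d -> 0 < a ->
  (\int[mu]_s (frac_kernel a (t - s) * mlf `|lam| d s)%:E = (mlf `|lam| (d + a) t)%:E)%E.
Proof.
move=> d0 a0; have da0 : 0 < d + a by rewrite addr_gt0.
have term0 b s k : 0 < b -> 0 <= ml_term `|lam| b s k.
  by move=> b0; rewrite mulr_ge0 ?exprn_ge0// frac_kernel_ge0//; exact: arg_gt0.
pose f k s := (frac_kernel a (t - s) * ml_term `|lam| d s k)%:E.
have f0 k s : (0 <= f k s)%E by rewrite lee_fin mulr_ge0 ?term0// frac_kernel_ge0.
have mf k : measurable_fun setT (f k).
  apply/measurable_EFinP; apply: measurable_funM.
    by apply: (measurableT_comp (measurable_frac_kernel _)); exact: measurable_funB.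
  by apply: measurable_funM => //; exact: measurable_frac_kernel.
have series_lim (u : nat -> R) (c : R) : cvgn (series u) ->
    (\sum_(k <oo) (c * u k)%:E = (c * limn (series u))%:E)%E.
  move=> cu; apply/cvg_lim => //.
  have -> : (fun n => \sum_(0 <= k < n) (c * u k)%:E)%E = EFin \o (fun n => c * series u n).
    by apply/funext => n /=; rewrite sumEFin -mulr_sumr.
  by apply: cvg_EFin; [exact: nearW|apply: cvgM; [exact: cvg_cst|exact: cu]].
have E s : ((frac_kernel a (t - s) * mlf `|lam| d s)%:E = \sum_(k <oo) f k s)%E.
  by rewrite /f series_lim//; exact: mlf_cvg.
under eq_integral do rewrite E.
rewrite integral_nneseries//.
have I k : (\int[mu]_s f k s = (1 * ml_term `|lam| (d + a) t k)%:E)%E.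
  rewrite /f /ml_term mul1r.
  have E2 s : (frac_kernel a (t - s) * (`|lam| ^+ k * frac_kernel (m * k%:R + d) s))%:E =
      ((`|lam| ^+ k)%:E * (frac_kernel a (t - s) * frac_kernel (m * k%:R + d) (s - 0))%:E)%E.
    by rewrite -EFinM subr0 mulrCA.
  under eq_integral do rewrite E2.
  rewrite integralZl//; last by apply: frac_kernel_conv_integrable => //; exact: arg_gt0.
  rewrite (frac_kernel_conv 0 t a0 (arg_gt0 k d0)).
  by rewrite -EFinM subr0; congr (_ * frac_kernel _ _)%:E; ring.
under eq_eseriesr do rewrite I.
by rewrite series_lim ?mul1r//; exact: mlf_cvg.
Qed.

Let rl_conv_mlf lam d a t s : rl_conv a (mlf lam d) t s = frac_kernel a (t - s) * mlf lam d s.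
Proof.
rewrite /rl_conv patchE; case: ifPn => //; rewrite notin_setE/= in_itv/= => /negP.
rewrite negb_and -!leNgt => /orP[s0|ts]; first by rewrite mlf_le0.
by rewrite frac_kernel_le0 ?mul0r// subr_le0.
Qed.

Let mlf_RL lam d a t : 0 < d -> 0 < a ->
  mu.-integrable setT (EFin \o rl_conv a (mlf lam d) t) /\
  (\int[mu]_s (rl_conv a (mlf lam d) t s)%:E = (mlf lam (d + a) t)%:E)%E.
Proof.
move=> d0 a0; have da0 : 0 < d + a by rewrite addr_gt0.
pose T k s := frac_kernel a (t - s) * ml_term lam d s k.
pose f n s := (\sum_(0 <= k < n) T k s)%:E.
have mT k : measurable_fun setT (T k).
  apply: measurable_funM.
    by apply: (measurableT_comp (measurable_frac_kernel _)); exact: measurable_funB.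
  by apply: measurable_funM => //; exact: measurable_frac_kernel.
have mf n : measurable_fun setT (f n).
  by apply/measurable_EFinP; exact: measurable_sum.
have fE n s : f n s = (frac_kernel a (t - s) * series (ml_term lam d s) n)%:E.
  by rewrite /f /T /series/= mulr_sumr.
have cf s : f ^~ s @ \oo --> (EFin \o rl_conv a (mlf lam d) t) s.
  have -> : f ^~ s = EFin \o (fun n => frac_kernel a (t - s) * series (ml_term lam d s) n).
    by apply/funext => n; rewrite fE.
  rewrite /= rl_conv_mlf; apply: cvg_EFin; first exact: nearW.
  by apply: cvgM; [exact: cvg_cst|exact: mlf_cvg].
have term_abs b s k : 0 < b -> `|ml_term lam b s k| = ml_term `|lam| b s k.
  move=> b0; rewrite /ml_term normrM normrX [`|frac_kernel _ _|]ger0_norm// frac_kernel_ge0//.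
  exact: arg_gt0.
have fg n s : (`|f n s| <= (frac_kernel a (t - s) * mlf `|lam| d s)%:E)%E.
  rewrite fE /= lee_fin normrM ger0_norm ?frac_kernel_ge0// ler_wpM2l ?frac_kernel_ge0//.
  apply: le_trans (ler_norm_sum _ _ _) _.
  under eq_bigr do rewrite term_abs//.
  apply: nondecreasing_cvgn_le; last exact: mlf_cvg.
  apply: nondecreasing_series => k _ _.
  by rewrite -term_abs.
have mg l : measurable_fun setT (fun s => (frac_kernel a (t - s) * mlf l d s)%:E).
  apply/measurable_EFinP; apply: measurable_funM; last exact: measurable_mlf.
  by apply: (measurableT_comp (measurable_frac_kernel _)); exact: measurable_funB.
have ig : mu.-integrable setT (fun s => (frac_kernel a (t - s) * mlf `|lam| d s)%:E).
  apply/integrableP; split; first exact: mg.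
  have E s : (`|(frac_kernel a (t - s) * mlf `|lam| d s)%:E| =
      (frac_kernel a (t - s) * mlf `|lam| d s)%:E)%E.
    rewrite /= ger0_norm// -lee_fin; apply: le_trans (fg 0 s); exact: abse_ge0.
  by under eq_integral do rewrite E; rewrite mlf_abs_integral// ltry.
have TE k s : (T k s)%:E = ((lam ^+ k)%:E *
      (frac_kernel a (t - s) * frac_kernel (m * k%:R + d) (s - 0))%:E)%E.
  by rewrite -EFinM subr0 /T /ml_term mulrCA.
have iT k : mu.-integrable setT (EFin \o T k).
  have := integrableZl measurableT (lam ^+ k)
    (@frac_kernel_conv_integrable R _ _ 0 t a0 (arg_gt0 k d0)).
  by apply: eq_integrable => // s _; rewrite -TE.
have mf' : measurable_fun setT (EFin \o rl_conv a (mlf lam d) t).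
  have -> : EFin \o rl_conv a (mlf lam d) t = (fun s => (frac_kernel a (t - s) * mlf lam d s)%:E).
    by apply/funext => s /=; rewrite rl_conv_mlf.
  exact: mg.
have aecf : {ae mu, forall s, setT s -> f ^~ s @ \oo --> (EFin \o rl_conv a (mlf lam d) t) s}.
  by apply/aeW => s _; exact: cf.
have aefg : {ae mu, forall s n, setT s ->
    (`|f n s| <= (frac_kernel a (t - s) * mlf `|lam| d s)%:E)%E}.
  by apply/aeW => s n _; exact: fg.
have [i _ c] := @dominated_convergence _ _ _ mu _ measurableT f
  (EFin \o rl_conv a (mlf lam d) t) _ mf mf' aecf ig aefg.
split => //; rewrite -(cvg_lim _ c)//.
have -> : (fun n => \int[mu]_s f n s)%E = EFin \o series (ml_term lam (d + a) t).
  apply/funext => n; rewrite /f.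
  under eq_integral do rewrite -sumEFin.
  rewrite integral_sum//= /series/= -sumEFin; apply: eq_bigr => k _.
  under eq_integral do rewrite TE.
  rewrite integralZl//; last by apply: frac_kernel_conv_integrable => //; exact: arg_gt0.
  rewrite (frac_kernel_conv 0 t a0 (arg_gt0 k d0)).
  by rewrite -EFinM subr0; congr (_ * frac_kernel _ _)%:E; ring.
by apply/cvg_lim => //; apply: cvg_EFin; [exact: nearW|exact: mlf_cvg].
Qed.

Lemma RL_integrable_mlf lam d a t : 0 < d -> 0 <= a -> RL_integrable a (mlf lam d) t.
Proof.
move=> d0; rewrite le_eqVlt => /predU1P[<-|a0]; first by move/eqP.
by apply/RL_integrableP => //; have [] := mlf_RL lam t d0 a0.
Qed.

(** Each term satisfies this rule by [frac_kernel_conv], and dominated convergence extends it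
    to the sum. *)
Lemma RL_integral_mlf lam d a t : 0 < d -> 0 <= a ->
  RL_integral a (mlf lam d) t = mlf lam (d + a) t.
Proof.
move=> d0; rewrite le_eqVlt => /predU1P[<-|a0]; first by rewrite addr0 /RL_integral eqxx.
apply: EFin_inj; rewrite RL_integralE//; last by apply: RL_integrable_mlf => //; exact: ltW.
by have [] := mlf_RL lam t d0 a0.
Qed.

(** By [RL_integral_mlf] with [a = 1], [mlf lam (d + 1)] is the primitive of the
    continuous function [mlf lam d]; no termwise differentiation is involved. *)
Lemma is_derive_mlf lam d t : 0 < d -> 0 < t ->
  is_derive t 1 (mlf lam (d + 1)) (mlf lam d t).
Proof.
move=> d0 t0.
have ig y : mu.-integrable `]0, y] (EFin \o mlf lam d).
  have /RL_integrable1 := @RL_integrable_mlf lam d 1 (y + 1) d0 ler01.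
  apply: integrableS => //; apply: subset_itvl; rewrite bnd_simp; lra.
pose F x := \int[mu]_(s in [set` Interval (BRight 0) (BRight x)]) mlf lam d s.
have FE x : F x = mlf lam (d + 1) x.
  rewrite -RL_integral_mlf// RL_integral1 /F -Rintegral_itv_bndo_bndc//.
  apply: integrableS (ig x) => //.
  by apply: subset_itvl; rewrite bnd_simp.
have [dF F'] : derivable F t 1 /\ derive1 F t = mlf lam d t.
  apply: (@continuous_FTC1 R (mlf lam d) (BRight 0) t (t + 1)) => //.
  - by rewrite ltrDl.
  - exact: mlf_continuous.
have FE' : F = mlf lam (d + 1) by apply/funext.
split; rewrite -FE'; first exact: dF.
by rewrite -derive1E; exact: F'.
Qed.

End MittagLeffler.

(* From here on [mlf] is known through its recursion, integral and derivative rules,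
   and its series is recalled only by [mlf_limE]. *)
#[global] Opaque mlf.

(** * Linearity and the homogeneous Volterra equation *)

Section RLLinear.
Context {R : realType}.
Implicit Types (a c d m lam t M T : R) (g : R -> R).
Local Notation mu := (@lebesgue_measure R).

Lemma RL_integrable_lin a c1 c2 g1 g2 t : 0 <= a ->
  RL_integrable a g1 t -> RL_integrable a g2 t ->
  RL_integrable a (fun s => c1 * g1 s + c2 * g2 s) t.
Proof.
move=> a0 i1 i2 an0.
have j1 := @integrableZl _ _ R mu _ (measurable_itv _) c1 _ (i1 an0).
have j2 := @integrableZl _ _ R mu _ (measurable_itv _) c2 _ (i2 an0).
have := @integrableD _ _ R mu _ (measurable_itv _) _ _ j1 j2.
by apply: eq_integrable => //= s _; rewrite -!EFinM -EFinD /RL_kernel; congr EFin; ring.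
Qed.

Lemma RL_integral_lin a c1 c2 g1 g2 t : 0 <= a ->
  RL_integrable a g1 t -> RL_integrable a g2 t ->
  RL_integral a (fun s => c1 * g1 s + c2 * g2 s) t =
  c1 * RL_integral a g1 t + c2 * RL_integral a g2 t.
Proof.
rewrite le_eqVlt => /predU1P[<-|a0] i1 i2; first by rewrite /RL_integral eqxx.
have j1 := i1 (lt0r_neq0 a0); have j2 := i2 (lt0r_neq0 a0).
have j1' := @integrableZl _ _ R mu _ (measurable_itv _) c1 _ j1.
have j2' := @integrableZl _ _ R mu _ (measurable_itv _) c2 _ j2.
rewrite /RL_integral (negbTE (lt0r_neq0 a0)).
rewrite [c1 * _]mulrCA [c2 * _]mulrCA -mulrDr; congr (_ * _).
rewrite -RintegralZl// -RintegralZl// -RintegralD//.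
by apply: eq_Rintegral => s _; rewrite /RL_kernel; ring.
Qed.

(** At [lam = 0] only the first term of the series remains, so the rules for [mlf]
    specialize to kernels. *)
Lemma mlf0 d t : 0 < d -> mlf 1 0 d t = frac_kernel d t.
Proof. by move=> d0; rewrite mlf_recl// mul0r addr0. Qed.

Lemma RL_integrable_frac_kernel a d t : 0 < d -> 0 <= a -> RL_integrable a (frac_kernel d) t.
Proof.
move=> d0 a0; have -> : frac_kernel d = mlf 1 0 d by apply/funext => s; rewrite mlf0.
exact: RL_integrable_mlf.
Qed.

Lemma RL_integral_frac_kernel a d t : 0 < d -> 0 <= a ->
  RL_integral a (frac_kernel d) t = frac_kernel (d + a) t.
Proof.
move=> d0 a0; have -> : frac_kernel d = mlf 1 0 d by apply/funext => s; rewrite mlf0.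
by rewrite RL_integral_mlf// mlf0// ltr_pwDl.
Qed.

(** Inserting the bound for [k] under the integral and using [frac_kernel_conv] produces the
    bound for [k + 1]: the bounds are the terms of a Mittag-Leffler series. *)
Lemma volterra_bound m lam T M (F : R -> R) : 0 < m ->
  (forall t, 0 < t <= T -> `|F t| <= M) ->
  (forall t, 0 < t <= T -> RL_integrable m F t) ->
  (forall t, 0 < t <= T -> F t = lam * RL_integral m F t) ->
  forall k t, 0 < t <= T -> `|F t| <= M * ml_term m `|lam| 1 t k.
Proof.
move=> m0 FM iF FE; elim => [|k IH] t /andP[t0 tT].
  by rewrite /ml_term expr0 mul1r mulr0 add0r frac_kernel1// mulr1 FM// t0.
have t0T : 0 < t <= T by rewrite t0.
have M0 : 0 <= M by apply: le_trans (FM t t0T).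
have mk0 : 0 < m * k%:R + 1 by rewrite ltr_wpDl// mulr_ge0// ltW.
have key : (`|(RL_integral m F t)%:E| <= (M * `|lam| ^+ k * frac_kernel (m * k%:R + 1 + m) t)%:E)%E.
  have iFt := iF t t0T; have iFt' := (RL_integrableP _ _ m0).1 iFt.
  rewrite RL_integralE//.
  apply: le_trans (le_abse_integral _ _ (measurable_int _ iFt')) _ => //.
  have -> : ((M * `|lam| ^+ k * frac_kernel (m * k%:R + 1 + m) t)%:E =
     \int[mu]_s ((M * `|lam| ^+ k)%:E *
       (frac_kernel m (t - s) * frac_kernel (m * k%:R + 1) (s - 0))%:E))%E.
    rewrite integralZl//; last exact: frac_kernel_conv_integrable.
    by rewrite (frac_kernel_conv 0 t m0 mk0) -EFinM subr0 [m + _]addrC.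
  apply: ge0_le_integral => //.
  - by apply: measurableT_comp => //; exact: measurable_int iFt'.
  - apply: emeasurable_funM => //.
    exact: measurable_int (frac_kernel_conv_integrable 0 t m0 mk0).
  move=> s _; rewrite /= -EFinM lee_fin subr0.
  have MK : 0 <= M * `|lam| ^+ k by rewrite mulr_ge0 ?exprn_ge0.
  have [st|st] := boolP (s \in `]0, t[); last first.
    by rewrite rl_conv_out// normr0 mulr_ge0// mulr_ge0 ?frac_kernel_ge0.
  rewrite /rl_conv patchE ifT; last by rewrite inE.
  rewrite [`|frac_kernel _ _ * _|]normrM ger0_norm ?frac_kernel_ge0// mulrCA.
  rewrite ler_wpM2l ?frac_kernel_ge0//.
  move: st; rewrite in_itv/= => /andP[s0 st].
  by apply: le_trans (IH s _) _; rewrite ?s0 ?(ltW (lt_le_trans st tT))// /ml_term mulrA.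
move: key; rewrite /= lee_fin => key.
rewrite FE// normrM.
have -> : M * ml_term m `|lam| 1 t k.+1 =
    `|lam| * (M * `|lam| ^+ k * frac_kernel (m * k%:R + 1 + m) t).
  rewrite /ml_term exprS; have -> : m * k.+1%:R + 1 = m * k%:R + 1 + m by rewrite -natr1; ring.
  ring.
by rewrite ler_wpM2l.
Qed.

(** The terms of a convergent series tend to 0. *)
Lemma volterra_zero m lam T M (F : R -> R) : 0 < m ->
  (forall t, 0 < t <= T -> `|F t| <= M) ->
  (forall t, 0 < t <= T -> RL_integrable m F t) ->
  (forall t, 0 < t <= T -> F t = lam * RL_integral m F t) ->
  forall t, 0 < t <= T -> F t = 0.
Proof.
move=> m0 FM iF FE t tT.
have c0 : M * ml_term m `|lam| 1 t k @[k --> \oo] --> M * 0.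
  by apply: cvgM; [exact: cvg_cst|apply: cvg_series_cvg_0; exact: mlf_cvg].
apply/eqP; rewrite -normr_le0.
have -> : 0 = lim (M * ml_term m `|lam| 1 t k @[k --> \oo]).
  by rewrite (cvg_lim _ c0)// mulr0.
apply: limr_ge; first by apply/cvg_ex; exists (M * 0).
by apply: nearW => k; exact: (volterra_bound m0 FM iF FE).
Qed.

End RLLinear.

(** * The Mittag-Leffler function of order one *)

Section GammaFactorial.
Context {R : realType}.

(** Compare two derivatives of [t^d / Gamma (d + 1)] at 1: the power rule gives
    [d / Gamma (d + 1)], and [is_derive_mlf] gives [1 / Gamma d]. *)
Lemma GammaS (d : R) : 0 < d -> Gamma (d + 1) = d * Gamma d.
Proof.
move=> d0.
have G1 : 0 < Gamma (d + 1) by rewrite Gamma_gt0 ?addr_gt0.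
have G0 := Gamma_gt0 d0.
have [_] := is_derive_mlf ltr01 0 d0 (@ltr01 R).
have -> : mlf 1 0 (d + 1) = frac_kernel (d + 1).
  by apply/funext => s; rewrite mlf0// addr_gt0.
rewrite mlf0// /frac_kernel tpowE// powR1 mul1r => h.
have : 'D_1 (fun x : R => (Gamma (d + 1))^-1 * x `^ d) 1 = (Gamma d)^-1.
  rewrite -h; apply: near_eq_derive => //; near=> y.
  rewrite tpowE; last by near: y; exact: lt_nbhsr.
  by rewrite addrK mulrC.
have dx := is_derive1_powR d (@ltr01 R).
rewrite -derive1E derive1Ml// derive1E derive_val powR1 mulr1 => E.
rewrite -[Gamma d]invrK -E invfM invrK mulrCA divff ?mulr1// gt_eqF//.
Unshelve. all: by end_near. Qed.

Lemma Gamma_nat (k : nat) : Gamma (k%:R + 1 : R) = k`!%:R.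
Proof.
elim: k => [|k IH]; first by rewrite add0r Gamma1 fact0.
by rewrite -natr1 GammaS ?IH ?factS ?natrM ?natr1// ltr_wpDl.
Qed.

Lemma mlf_exp (lam t : R) : 0 < t -> mlf 1 lam 1 t = expR (lam * t).
Proof.
move=> t0; rewrite mlf_limE /expR; congr (lim (series _ @ \oo)).
apply/funext => k; rewrite /ml_term /frac_kernel mul1r tpowE// addrK powR_mulrn ?ltW//.
by rewrite Gamma_nat /exp_coeff/= exprMn mulrA.
Qed.

End GammaFactorial.

(** * The Hilfer equation *)

Section HilferEquation.
Context {R : realType}.
Implicit Types (s t xi C : R) (p q f g : R -> R).
Local Notation mu := (@lebesgue_measure R).

Lemma is_derive_near_gt0 f g t df : 0 < t -> (forall s, 0 < s -> f s = g s) ->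
  is_derive t 1 f df -> is_derive t 1 g df.
Proof.
move=> t0 fg [d D].
have N : \forall s \near t, f s = g s.
  by near=> s; apply: fg; near: s; exact: lt_nbhsr.
split; first by apply: near_eq_derivable d.
by rewrite -D; apply: near_eq_derive; near do apply/esym.
Unshelve. all: by end_near. Qed.

Let subrACA_eq (x y u v d e : R) : x - y = d -> u - v = e ->
  d - e = x - u - (y - v).
Proof. by move=> <- <-; ring. Qed.

Let sub_swap (x y u v : R) : u - v = x - y -> x - u = y - v.
Proof. by move=> h; lra. Qed.

Variables m a b lam : R.
Hypotheses (m0 : 0 < m) (a0 : 0 <= a) (b0 : 0 <= b) (mab : m + a + b = 1).

Let ma0 : 0 < m + a. Proof. exact: ltr_wpDr. Qed.
Let mb0 : 0 < m + b. Proof. exact: ltr_wpDr. Qed.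
Let m10 : 0 < m + 1. Proof. exact: addr_gt0. Qed.

(** The equation [I^b (I^a p)' = xi + lam p] with orders [a] and [b] free up to
    [m + a + b = 1]; [a] and [b] may vanish independently, where [I^0] is the
    identity. *)
Definition hilfer_solution xi p := forall t, 0 < t ->
  [/\ RL_integrable a p t,
      derivable (RL_integral a p) t 1,
      RL_integrable b (derive1 (RL_integral a p)) t &
      RL_integral b (derive1 (RL_integral a p)) t = xi + lam * p t].

Definition ml_solution xi C t :=
  C * mlf m lam (m + b) t + xi * mlf m lam (m + 1) t.

(** The function [I^a (ml_solution xi C)]; its first summand has the limit [C] at 0,
    which is how [C] is recovered from a solution. *)
Definition ml_primitive xi C t :=
  C * mlf m lam 1 t + xi * mlf m lam (m + 1 + a) t.

(** The derivative of [ml_primitive].  The constant [C] in [C * mlf m lam 1] disappears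
    and leaves the factor [lam]. *)
Definition ml_derivative xi C t :=
  C * lam * mlf m lam m t + xi * mlf m lam (m + a) t.

Lemma mlf1E t : 0 < t -> mlf m lam 1 t = 1 + lam * mlf m lam (m + 1) t.
Proof.
move=> t0; apply: etrans (mlf_recl m0 lam t ltr01) _.
congr (_ + _ * mlf _ _ _ _); [exact: frac_kernel1 | exact: addrC].
Qed.

Let RL_integral_mlf2 s (c1 c2 d1 d2 e1 e2 : R) t : 0 <= s -> 0 < d1 -> 0 < d2 ->
  d1 + s = e1 -> d2 + s = e2 ->
  RL_integral s (fun t => c1 * mlf m lam d1 t + c2 * mlf m lam d2 t) t =
  c1 * mlf m lam e1 t + c2 * mlf m lam e2 t.
Proof.
move=> s0 d10 d20 <- <-.
have h1 := RL_integrable_mlf m0 lam t d10 s0.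
have h2 := RL_integrable_mlf m0 lam t d20 s0.
apply: etrans (RL_integral_lin c1 c2 s0 h1 h2) _.
congr (_ * _ + _ * _).
  exact: (RL_integral_mlf m0 lam t d10 s0).
exact: (RL_integral_mlf m0 lam t d20 s0).
Qed.

Let RL_integrable_mlf2 s (c1 c2 d1 d2 : R) t : 0 <= s -> 0 < d1 -> 0 < d2 ->
  RL_integrable s (fun t => c1 * mlf m lam d1 t + c2 * mlf m lam d2 t) t.
Proof.
move=> s0 d10 d20; apply: (RL_integrable_lin c1 c2 s0).
  exact: (RL_integrable_mlf m0 lam t d10 s0).
exact: (RL_integrable_mlf m0 lam t d20 s0).
Qed.

Lemma RL_integrable_ml_solution xi C t : RL_integrable a (ml_solution xi C) t.
Proof. exact: RL_integrable_mlf2. Qed.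

Lemma RL_integral_ml_solution xi C t :
  RL_integral a (ml_solution xi C) t = ml_primitive xi C t.
Proof. by apply: RL_integral_mlf2 => //; rewrite addrAC. Qed.

(** The index 1 cannot be lowered by [is_derive_mlf], whose target index must be
    positive; [mlf1E] splits off the constant first. *)
Lemma is_derive_ml_primitive xi C t : 0 < t ->
  is_derive t 1 (ml_primitive xi C) (ml_derivative xi C t).
Proof.
move=> t0.
have dm := is_derive_mlf m0 lam m0 t0.
have dma := is_derive_mlf m0 lam ma0 t0.
pose h : R -> R := (cst C + (C * lam) *: (mlf m lam (m + 1))) +
  xi *: (mlf m lam (m + a + 1)).
have hE s : 0 < s -> h s = ml_primitive xi C s.
  move=> s0; rewrite /ml_primitive (mlf1E s0) mulrDr mulr1 mulrA -[m + 1 + a]addrAC.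
  by [].
have d1 := is_deriveZ (C * lam) dm.
have d2 := is_deriveZ xi dma.
have := is_deriveD (is_deriveD (is_derive_cst C t 1) d1) d2.
by rewrite add0r; exact: is_derive_near_gt0.
Qed.

Lemma RL_integrable_ml_derivative s xi C t : 0 <= s ->
  RL_integrable s (ml_derivative xi C) t.
Proof. by move=> s0; exact: RL_integrable_mlf2. Qed.

Lemma RL_integral_ml_derivative s xi C t : 0 <= s ->
  RL_integral s (ml_derivative xi C) t =
  C * lam * mlf m lam (m + s) t + xi * mlf m lam (m + a + s) t.
Proof. by move=> s0; exact: RL_integral_mlf2. Qed.

Lemma ml_solutionP xi C : hilfer_solution xi (ml_solution xi C).
Proof.
have FE : RL_integral a (ml_solution xi C) = ml_primitive xi C.
  by apply/funext => s; exact: RL_integral_ml_solution.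
have GE (s : R) : 0 < s -> derive1 (ml_primitive xi C) s = ml_derivative xi C s.
  by move=> s0; have [_] := is_derive_ml_primitive xi C s0; rewrite -derive1E.
move=> t t0; split; rewrite ?FE.
- exact: RL_integrable_ml_solution.
- by have [] := is_derive_ml_primitive xi C t0.
- apply: RL_integrable_eq (RL_integrable_ml_derivative xi C t b0).
  by move=> s /andP[s0 _]; rewrite GE.
- apply: (@etrans _ _ (RL_integral b (ml_derivative xi C) t)).
    by apply: RL_integral_eq => // s /andP[s0 _]; exact: GE.
  apply: etrans (RL_integral_ml_derivative xi C t b0) _.
  have -> : mlf m lam (m + a + b) t = 1 + lam * mlf m lam (m + 1) t.
    by rewrite mab; exact: mlf1E.
  rewrite /ml_solution.
  generalize (mlf m lam (m + b) t) (mlf m lam (m + 1) t) => u v; ring.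
Qed.

(** The equation only sees the values on [0 < t], which is an open condition. *)
Lemma hilfer_solution_eq xi p q : (forall t, 0 < t -> p t = q t) ->
  hilfer_solution xi p -> hilfer_solution xi q.
Proof.
move=> pq sp t t0; have [i d j e] := sp t t0.
have Fpq (s : R) : 0 < s -> RL_integral a p s = RL_integral a q s.
  by move=> s0; apply: RL_integral_eq => // r /andP[r0 _]; exact: pq.
have dF (s : R) : 0 < s -> is_derive s 1 (RL_integral a q) (derive1 (RL_integral a p) s).
  move=> s0; apply: (is_derive_near_gt0 s0 Fpq).
  by have [_ ds _ _] := sp s s0; split; [exact: ds|rewrite derive1E].
have Gpq (s : R) : 0 < s -> derive1 (RL_integral a p) s = derive1 (RL_integral a q) s.
  by move=> s0; have [_] := dF s s0; rewrite -derive1E => ->.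
split.
- by apply: RL_integrable_eq i => r /andP[r0 _]; exact: pq.
- by have [] := dF t t0.
- by apply: RL_integrable_eq j => r /andP[r0 _]; exact: Gpq.
- have E : RL_integral b (derive1 (RL_integral a q)) t =
      RL_integral b (derive1 (RL_integral a p)) t.
    by apply: (RL_integral_eq b t0) => s /andP[s0 _]; exact: esym (Gpq s s0).
  by rewrite E e (pq t t0).
Qed.

Section difference.
Variables (xi : R) (p q : R -> R).
Hypotheses (sp : hilfer_solution xi p) (sq : hilfer_solution xi q).

Let d s := 1 * p s + -1 * q s.

Let F_sub s : 0 < s ->
  RL_integral a p s - RL_integral a q s = RL_integral a d s.
Proof.
move=> s0; have [ip _ _ _] := sp s0; have [iq _ _ _] := sq s0.
by rewrite (RL_integral_lin 1 (-1) a0 ip iq) mul1r mulN1r.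
Qed.

Let dF s : 0 < s -> is_derive s 1 (RL_integral a d)
  (derive1 (RL_integral a p) s - derive1 (RL_integral a q) s).
Proof.
move=> s0; have [_ dp _ _] := sp s0; have [_ dq _ _] := sq s0.
have D : is_derive s 1 (RL_integral a p - RL_integral a q)
    (derive1 (RL_integral a p) s - derive1 (RL_integral a q) s).
  by rewrite !derive1E; apply: is_deriveB; split; [exact: dp| |exact: dq|].
exact: is_derive_near_gt0 s0 F_sub D.
Qed.

Let G_sub s : 0 < s ->
  1 * derive1 (RL_integral a p) s + -1 * derive1 (RL_integral a q) s =
  derive1 (RL_integral a d) s.
Proof.
by move=> s0; have [_] := dF s0; rewrite -derive1E mul1r mulN1r => ->.
Qed.

Let RL_G_sub s t : 0 <= s -> 0 < t ->
  RL_integrable s (derive1 (RL_integral a p)) t ->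
  RL_integrable s (derive1 (RL_integral a q)) t ->
  RL_integral s (derive1 (RL_integral a d)) t =
  RL_integral s (derive1 (RL_integral a p)) t -
  RL_integral s (derive1 (RL_integral a q)) t.
Proof.
move=> s0 t0 jp jq; have E := RL_integral_lin 1 (-1) s0 jp jq.
rewrite mul1r mulN1r in E; rewrite -E; apply/esym.
by apply: (RL_integral_eq s t0) => r /andP[r0 _]; exact: G_sub.
Qed.

Lemma hilfer_solution_sub : hilfer_solution 0 d.
Proof.
move=> t t0; have [ip dp jp ep] := sp t0; have [iq dq jq eq_] := sq t0.
split.
- exact: RL_integrable_lin.
- by have [] := dF t0.
- by apply: RL_integrable_eq (RL_integrable_lin 1 (-1) b0 jp jq) => s /andP[s0 _]; exact: G_sub.
- by rewrite RL_G_sub// ep eq_ /d; ring.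
Qed.

(** The quantity [F t - I^1 G t], with [F = I^a p] and [G = F'], is the limit of [F] at
    0; it is additive in the solution. *)
Lemma initial_value_sub t : 0 < t ->
  RL_integrable 1 (derive1 (RL_integral a p)) t ->
  RL_integrable 1 (derive1 (RL_integral a q)) t ->
  RL_integral a d t - RL_integral 1 (derive1 (RL_integral a d)) t =
  (RL_integral a p t - RL_integral 1 (derive1 (RL_integral a p)) t) -
  (RL_integral a q t - RL_integral 1 (derive1 (RL_integral a q)) t).
Proof.
move=> t0 jp jq; exact: (subrACA_eq (F_sub t0) (esym (RL_G_sub ler01 t0 jp jq))).
Qed.

End difference.

Section order_lt1.
Hypothesis m1 : m < 1.
Variables (xi : R) (p : R -> R).
Hypothesis sp : hilfer_solution xi p.

Local Notation F := (RL_integral a p).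
Local Notation G := (derive1 (RL_integral a p)).

Let m10' : 0 < 1 - m. Proof. by rewrite subr_gt0. Qed.
Let abE : a + b = 1 - m. Proof. by rewrite -mab; ring. Qed.

Let rhs_eq t : 0 < t -> RL_integral b G t = xi * frac_kernel 1 t + lam * p t.
Proof. by move=> t0; have [_ _ _ ->] := sp t0; rewrite frac_kernel1// mulr1. Qed.

(** For [b = 0] the equation itself expresses [G] by integrable functions; otherwise
    [G] is integrable against the order [b], hence [1 - m = a + b]. *)
Lemma hilfer_derivative_integrable t : 0 < t -> RL_integrable (1 - m) G t.
Proof.
move=> t0; have [ip _ iG _] := sp t0.
have [b0'|bn0] := eqVneq b 0.
  have a_eq : a = 1 - m by rewrite -abE b0' addr0.
  rewrite -a_eq; apply: RL_integrable_eq (RL_integrable_lin xi lam a0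
    (RL_integrable_frac_kernel t ltr01 a0) ip) => s /andP[s0 _].
  by rewrite -rhs_eq// b0' RL_integral0.
have bp : 0 < b by rewrite lt_neqAle eq_sym bn0.
have [a_eq|an0] := eqVneq a 0.
  by have <- : b = 1 - m by rewrite -abE a_eq add0r.
have ap : 0 < a by rewrite lt_neqAle eq_sym an0.
by rewrite -abE; exact: RL_integrableD.
Qed.

(** Apply [I^a] to the equation. *)
Lemma hilfer_first_integral t : 0 < t ->
  RL_integral (1 - m) G t = xi * frac_kernel (1 + a) t + lam * F t.
Proof.
move=> t0; have [ip _ iG _] := sp t0.
have step : RL_integral a (RL_integral b G) t = xi * frac_kernel (1 + a) t + lam * F t.
  have i1 := RL_integrable_frac_kernel t ltr01 a0.
  rewrite -(RL_integral_frac_kernel t ltr01 a0) -(RL_integral_lin xi lam a0 i1 ip).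
  by apply: (RL_integral_eq a t0) => s /andP[s0 _]; exact: rhs_eq.
rewrite -step.
have [b0'|bn0] := eqVneq b 0.
  have a_eq : a = 1 - m by rewrite -abE b0' addr0.
  by rewrite -a_eq b0'; congr RL_integral; apply/funext => s; rewrite RL_integral0.
have bp : 0 < b by rewrite lt_neqAle eq_sym bn0.
have [a_eq|an0] := eqVneq a 0.
  have <- : b = 1 - m by rewrite -abE a_eq add0r.
  by rewrite a_eq RL_integral0.
have ap : 0 < a by rewrite lt_neqAle eq_sym an0.
by rewrite -abE RL_semigroup// => s /andP[s0 _]; have [] := sp s0.
Qed.

(** Apply [I^m] to [hilfer_first_integral]. *)
Lemma hilfer_second_integral t : 0 < t ->
  RL_integral 1 G t = RL_integral m (fun s => xi * frac_kernel (1 + a) s + lam * F s) t.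
Proof.
move=> t0; have m1E : m + (1 - m) = 1 by rewrite addrC subrK.
rewrite -[in LHS]m1E -RL_semigroup//.
  by apply: (RL_integral_eq m t0) => s /andP[s0 _]; exact: hilfer_first_integral.
by move=> s /andP[s0 _]; exact: hilfer_derivative_integrable.
Qed.

(** Solve [hilfer_first_integral] for [F]; the left-hand side is integrable by the
    semigroup law. *)
Lemma hilfer_primitive_integrable t : lam != 0 -> 0 < t -> RL_integrable m F t.
Proof.
move=> lam0 t0.
have i1 : RL_integrable m (RL_integral (1 - m) G) t.
  apply: RL_semigroup_integrable => // s /andP[s0 _].
  exact: hilfer_derivative_integrable.
have a10 : 0 < 1 + a by rewrite ltr_pwDl.
have i2 := RL_integrable_frac_kernel t a10 (ltW m0).
have := RL_integrable_lin lam^-1 (- (lam^-1 * xi)) (ltW m0) i1 i2.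
apply: RL_integrable_eq => s /andP[s0 _].
by rewrite hilfer_first_integral//; field.
Qed.

Lemma hilfer_derivative_integrable1 t : 0 < t -> mu.-integrable `]0, t[ (EFin \o G).
Proof.
move=> t0; apply/RL_integrable1.
have <- : m + (1 - m) = 1 by rewrite addrC subrK.
by apply: RL_integrableD => //; exact: hilfer_derivative_integrable.
Qed.

(** [F] and the indefinite integral of [G = F'] differ by a constant, since [F] is
    differentiable at every point of [s, t] and [G] is integrable down to 0. *)
Lemma hilfer_primitive_FTC s t : 0 < s -> s <= t ->
  F t - RL_integral 1 G t = F s - RL_integral 1 G s.
Proof.
move=> s0 st; have t0 : 0 < t by exact: lt_le_trans st.
have iT := hilfer_derivative_integrable1 (addr_gt0 t0 (@ltr01 R)).
have ic : mu.-integrable `]0, t] (EFin \o G).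
  by apply: integrableS iT => //; apply: subset_itvl; rewrite bnd_simp ltrDl.
have iS : mu.-integrable `[s, t] (EFin \o G).
  by apply: integrableS ic => //; apply: subset_itvr; rewrite bnd_simp.
have FTC : \int[mu]_(x in `[s, t]) G x = F t - F s.
  apply: Rintegral_derive1 => // x /andP[sx _].
  by have [] := sp (lt_le_trans s0 sx).
have bE (u : R) : 0 < u -> u <= t -> RL_integral 1 G u = \int[mu]_(x in `]0, u]) G x.
  move=> u0 ut; rewrite RL_integral1 Rintegral_itv_bndo_bndc//.
  by apply: integrableS ic => //; apply: subset_itvl; rewrite bnd_simp.
rewrite (bE t t0 (lexx t)) (bE s s0 st).
have := Rintegral_itvB ic (x := s).
rewrite bnd_simp => /(_ (ltW s0)); rewrite bnd_simp => /(_ st).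
have -> : \int[mu]_(x in `]s, t]) G x = F t - F s.
  rewrite -FTC Rintegral_itv_obnd_cbnd//.
  by apply: integrableS iS => //; apply: subset_itvr; rewrite bnd_simp.
exact: sub_swap.
Qed.

End order_lt1.

Lemma initial_value_ml_solution xi C t : 0 < t ->
  RL_integral a (ml_solution xi C) t -
  RL_integral 1 (derive1 (RL_integral a (ml_solution xi C))) t = C.
Proof.
move=> t0.
have FE : RL_integral a (ml_solution xi C) = ml_primitive xi C.
  by apply/funext => s; exact: RL_integral_ml_solution.
have E : RL_integral 1 (derive1 (ml_primitive xi C)) t =
    C * lam * mlf m lam (m + 1) t + xi * mlf m lam (m + a + 1) t.
  apply: etrans (RL_integral_ml_derivative xi C t ler01).
  apply: (RL_integral_eq 1 t0) => s /andP[s0 _].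
  by have [_] := is_derive_ml_primitive xi C s0; rewrite -derive1E.
rewrite FE E /ml_primitive (mlf1E t0) -[m + a + 1]addrAC.
have H (c u v : R) : c * (1 + lam * u) + xi * v - (c * lam * u + xi * v) = c by ring.
exact: H.
Qed.

Section homogeneous.
Variable q : R -> R.
Hypotheses (m1 : m < 1) (lam0 : lam != 0) (sq : hilfer_solution 0 q).
Local Notation F := (RL_integral a q).
Local Notation G := (derive1 (RL_integral a q)).
(* The initial value may be read off at any time, by [hilfer_primitive_FTC]. *)
Hypothesis initial_value0 : F 1 - RL_integral 1 G 1 = 0.

Let F_RL1 t : 0 < t -> F t = RL_integral 1 G t.
Proof.
move=> t0; apply: subr0_eq.
have [t1|/ltW t1] := leP 1 t.
  exact: etrans (hilfer_primitive_FTC m1 sq ltr01 t1) initial_value0.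
exact: etrans (esym (hilfer_primitive_FTC m1 sq t0 t1)) initial_value0.
Qed.

Let F_RLm t : 0 < t -> F t = lam * RL_integral m F t.
Proof.
move=> t0; apply: etrans (F_RL1 t0) _.
apply: etrans (hilfer_second_integral m1 sq t0) _.
have a10 : 0 < 1 + a by rewrite ltr_pwDl.
have i2 := RL_integrable_frac_kernel t a10 (ltW m0).
have i1 := hilfer_primitive_integrable m1 sq lam0 t0.
apply: etrans (RL_integral_lin 0 lam (ltW m0) i2 i1) _.
by rewrite mul0r add0r.
Qed.

Let F_bound t : 0 < t ->
  forall s, 0 < s <= t -> `|F s| <= \int[mu]_(x in `]0, t[) `|G x|.
Proof.
move=> t0 s /andP[s0 st].
have iG := hilfer_derivative_integrable1 m1 sq.
have iN u : 0 < u -> mu.-integrable `]0, u[ (EFin \o (fun x => `|G x|)).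
  by move=> u0; exact: (integrable_norm (iG u u0)).
rewrite (F_RL1 s0) RL_integral1.
apply: le_trans (le_normr_Rintegral _ (iG s s0)) _; first exact: measurable_itv.
apply: fine_le.
- by apply: integrable_fin_num; [exact: measurable_itv|exact: iN].
- by apply: integrable_fin_num; [exact: measurable_itv|exact: iN].
- apply: ge0_subset_integral => //; first exact: measurable_int (iN t t0).
  by apply: subset_itvl; rewrite bnd_simp.
Qed.

Let F0 t : 0 < t -> F t = 0.
Proof.
move=> t0; apply: (volterra_zero m0 (F_bound t0)); last by rewrite t0 lexx.
- by move=> s /andP[s0 _]; exact: (hilfer_primitive_integrable m1 sq lam0 s0).
- by move=> s /andP[s0 _]; exact: F_RLm.
Qed.

Let G0 t : 0 < t -> G t = 0.
Proof.
move=> t0.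
have E s : 0 < s -> cst 0 s = F s by move=> s0; rewrite F0.
have [_] := is_derive_near_gt0 t0 E (is_derive_cst 0 t 1).
by rewrite -derive1E.
Qed.

(** [F] is bounded near 0 as an integral of [G] and satisfies [F = lam I^m F], so it
    vanishes, and so does [G = F'].  The equation [lam q = I^b G] then gives [q] at
    every point. *)
Lemma hilfer_homogeneous t : 0 < t -> q t = 0.
Proof.
move=> t0; have [_ _ _] := sq t0; rewrite add0r => h.
have E : RL_integral b G t = RL_integral b (cst 0) t.
  by apply: (RL_integral_eq b t0) => s /andP[s0 _]; exact: G0.
apply: (mulfI lam0); apply: etrans (esym h) (etrans E _).
rewrite mulr0 /RL_integral; case: ifP => // _.
rewrite /Rintegral integral0_eq ?mulr0// => s _.
by rewrite /RL_kernel mulr0.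
Qed.

End homogeneous.

(** The constant [C] is the initial value of [I^a p], read off at [t = 1]; the
    difference with [ml_solution xi C] has initial value 0. *)
Lemma hilfer_solution_unique_lt1 xi p : m < 1 -> lam != 0 -> hilfer_solution xi p ->
  exists C, forall t, 0 < t -> p t = ml_solution xi C t.
Proof.
move=> m1 lam0 sp.
pose C := RL_integral a p 1 - RL_integral 1 (derive1 (RL_integral a p)) 1.
exists C => t t0.
have sq := ml_solutionP xi C.
have sd := hilfer_solution_sub sp sq.
have jp := hilfer_derivative_integrable1 m1 sp ltr01.
have jq := hilfer_derivative_integrable1 m1 sq ltr01.
have := initial_value_sub sp sq ltr01 ((RL_integrable1 _ _).2 jp) ((RL_integrable1 _ _).2 jq).
move=> e; have {}e := etrans e (congr1 (fun x => C - x) (initial_value_ml_solution xi C ltr01)).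
rewrite subrr in e.
have := hilfer_homogeneous m1 lam0 sd e t0.
rewrite mul1r mulN1r => /eqP; rewrite subr_eq0 => /eqP; exact.
Qed.

End HilferEquation.

(** * Order one *)

Section OrderOne.
Context {R : realType}.
Implicit Types (lam xi t K : R) (p w : R -> R).

Lemma derive0_gt0_cst w : (forall t, 0 < t -> is_derive t 1 w 0) ->
  forall t, 0 < t -> w t = w 1.
Proof.
move=> dw.
have main s t : 0 < s -> s < t -> w t = w s.
  move=> s0 st.
  have [| |c _] := @MVT R w (fun=> 0) s t st.
  - by move=> x; rewrite in_itv/= => /andP[sx _]; apply: dw; exact: lt_trans sx.
  - apply: derivable_within_continuous => x; rewrite in_itv/= => /andP[sx _].
    by have [] := dw x (lt_le_trans s0 sx).
  by rewrite mul0r => /subr0_eq.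
move=> t t0; have [t1|t1|->//] := ltgtP t 1; last exact: main.
by apply/esym; exact: main.
Qed.

(** The function [(xi + lam p) exp (- lam t)] has derivative 0. *)
Lemma hilfer_solution_unique_1 lam xi p : lam != 0 ->
  hilfer_solution 0 0 lam xi p ->
  exists C, forall t, 0 < t -> p t = ml_solution 1 0 lam xi C t.
Proof.
move=> lam0 sp.
have RL0 (g : R -> R) : RL_integral 0 g = g by apply/funext => s; exact: RL_integral0.
have dp t : 0 < t -> is_derive t 1 p (xi + lam * p t).
  move=> t0; have [_ d _ e] := sp t t0.
  by rewrite !RL0 in d e; split; [exact: d|rewrite -derive1E].
pose w t := (xi + lam * p t) * expR (- lam * t).
have dw t : 0 < t -> is_derive t 1 w 0.
  move=> t0.
  have d1 := is_deriveD (is_derive_cst xi t 1) (is_deriveZ lam (dp t t0)).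
  have d2 : is_derive t 1 (fun t => expR (- lam * t)) (expR (- lam * t) * - lam).
    have dl := is_deriveZ (- lam) (is_derive_id t (1 : R)).
    rewrite [_ *: 1]mulr1 in dl.
    exact: is_derive1_comp (is_derive_expR _) dl.
  have D := is_deriveM d1 d2; rewrite add0r in D.
  have E (u e : R) : u * (e * - lam) + e * (lam * u) = 0 by ring.
  by rewrite -(E (xi + lam * p t) (expR (- lam * t))).
have wE t : 0 < t -> xi + lam * p t = w 1 * expR (lam * t).
  move=> t0; rewrite -(derive0_gt0_cst dw t0) /w -mulrA -expRD mulNr addNr expR0 mulr1//.
exists ((w 1 - xi) / lam) => t t0.
have e1 : mlf 1 lam (1 + 0) t = expR (lam * t) by rewrite addr0 mlf_exp.
have e2 : lam * mlf 1 lam (1 + 1) t = expR (lam * t) - 1.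
  by rewrite -(mlf_exp _ t0) (mlf1E lam ltr01 t0) addrAC subrr add0r.
rewrite /ml_solution e1.
have e3 : mlf 1 lam (1 + 1) t = (expR (lam * t) - 1) / lam.
  by rewrite -e2 mulrC mulKf.
have e4 : p t = (w 1 * expR (lam * t) - xi) / lam.
  by rewrite -(wE t t0) addrAC subrr add0r mulrC mulKf.
rewrite e3 e4; generalize (w 1) (expR (lam * t)) => K e.
by field.
Qed.

End OrderOne.

(** * The cobweb model *)

Section Cobweb.
Context {R : realType}.
Variables (alpha beta alpha1 beta1 m nu : R).
Hypotheses (beta0 : beta != 0) (m0 : 0 < m) (m1 : m <= 1) (nu0 : 0 <= nu) (nu1 : nu <= 1).
Local Notation lam := ((beta1 - beta) / beta).
Local Notation xi := ((alpha1 - alpha) / beta).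
Local Notation a := ((1 - nu) * (1 - m)).
Local Notation b := (nu * (1 - m)).

(** Besides the division by [beta], the existence conditions change form: those of
    the model range over all of ]0, t] but are imposed for every [t]. *)
Lemma cobweb_hilfer p : cobweb_solution alpha beta alpha1 beta1 m nu p <->
  hilfer_solution a b lam xi p.
Proof.
have E t : cobweb_demand alpha beta m nu p t = cobweb_supply alpha1 beta1 p t <->
    hilfer_derivative m nu p t = xi + lam * p t.
  rewrite /cobweb_demand /cobweb_supply.
  generalize (hilfer_derivative m nu p t) (p t) => h q.
  split => e.
    have : beta * h = alpha1 - alpha + (beta1 - beta) * q by lra.
    by move=> {}e; apply: (mulfI beta0); rewrite e; field.
  by rewrite e; field.
split => sp t t0.
- have [[d1 d2 d3] /E e] := sp t t0; split => //.
  + by apply: d1; rewrite t0 lexx.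
  + by apply: d2; rewrite t0 lexx.
- have [_ _ d3 e] := sp t t0; split; last exact/E.
  split => //.
  + by move=> s /andP[s0 _]; have [] := sp s s0.
  + by move=> s /andP[s0 _]; have [] := sp s s0.
Qed.

End Cobweb.

Theorem theorem3p1 (R : realType) (alpha beta alpha1 beta1 mu nu : R)
    (beta_neq0 : beta != 0) (beta_neq_beta1 : beta != beta1)
    (mu_gt0 : 0 < mu) (mu_le1 : mu <= 1) (nu_ge0 : 0 <= nu) (nu_le1 : nu <= 1) :
  let gamma := mu + nu - mu * nu in
  let lambda := (beta1 - beta) / beta in
  let xi := (alpha1 - alpha) / beta in
  forall p : R -> R,
    cobweb_solution alpha beta alpha1 beta1 mu nu p <->
    exists C : R, forall t : R, 0 < t ->
      p t = C * t `^ (gamma - 1) * mittag_leffler2 mu gamma (lambda * t `^ mu)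
            - xi / lambda
            + xi / lambda * mittag_leffler mu (lambda * t `^ mu).
Proof.
move=> gamma lambda xi p.
have lambda0 : lambda != 0.
  by rewrite mulf_neq0 ?invr_neq0// subr_eq0 eq_sym.
have a0 : 0 <= (1 - nu) * (1 - mu) by rewrite mulr_ge0 ?subr_ge0.
have b0 : 0 <= nu * (1 - mu) by rewrite mulr_ge0 ?subr_ge0.
have mab : mu + (1 - nu) * (1 - mu) + nu * (1 - mu) = 1 by ring.
have gammaE : gamma = mu + nu * (1 - mu) by rewrite /gamma; ring.
have gamma0 : 0 < gamma by rewrite gammaE ltr_wpDr.
have formula C t : 0 < t ->
    C * t `^ (gamma - 1) * mittag_leffler2 mu gamma (lambda * t `^ mu) - xi / lambda
      + xi / lambda * mittag_leffler mu (lambda * t `^ mu) =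
    ml_solution mu (nu * (1 - mu)) lambda xi C t.
  move=> t0.
  have e1 := mittag_leffler2E mu_gt0 lambda gamma0 t0.
  have e2 := mittag_leffler2E mu_gt0 lambda ltr01 t0.
  rewrite subrr powRr0 mul1r (mlf1E lambda mu_gt0 t0) in e2.
  rewrite /mittag_leffler e2 -mulrA e1 /ml_solution -gammaE.
  generalize (mlf mu lambda gamma t) (mlf mu lambda (mu + 1) t) => u v.
  by field.
apply: iff_trans (cobweb_hilfer _ _ _ _ _ _ _) _ => //.
rewrite -/lambda -/xi; split => [sp|[C pE]].
- have [C pE] : exists C, forall t, 0 < t ->
      p t = ml_solution mu (nu * (1 - mu)) lambda xi C t.
    have [mu1|mu1|mu1] := ltgtP mu 1; last 2 first.
    + by move: mu_le1; rewrite leNgt mu1.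
    + move: sp; rewrite mu1 subrr !mulr0; exact: hilfer_solution_unique_1.
    exact: hilfer_solution_unique_lt1 sp.
  by exists C => t t0; rewrite formula// pE.
- have sq := ml_solutionP lambda mu_gt0 a0 b0 mab xi C.
  by apply: hilfer_solution_eq sq => t t0; rewrite pE// formula.
Qed.
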